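(* Let $F=\{p_0,\ldots,p_n\}\subset\mathbb{R}$ contain at least two distinct points and consider the homogeneous IFS $S_i(x)=\lambda x+(1-\lambda)p_i$, $i=0,\ldots,n$. If $\lambda\in(2^{-1/2},1)$ and $\lambda^{-2}$ is not a Pisot number, then $\mathrm{int}(X)=X_{uni}$. In particular, if $\lambda\in(\theta^{-1/2},1)$ where $\theta=1.3247\ldots$ is the smallest Pisot number (the real root of $x^3-x-1$), then $\mathrm{int}(X)=X_{uni}$.
   Context: $\mathcal{D}=\{0,\ldots,n\}$. $X\subset\mathbb{R}$ is the unique non-empty compact set with $X=\bigcup_{i\in\mathcal{D}}S_i(X)$. The coding map is $\pi(\mathbf{a})=\lim_{j\to\infty}(S_{a_1}\circ\cdots\circ S_{a_j})(0)$. A sequence in $\mathcal{D}^{\mathbb{N}}$ is universal if it contains every finite word over $\mathcal{D}$ as a block of consecutive digits; $X_{uni}$ is the set of $x\in X$ with a universal $\mathbf{a}$ satisfying $\pi(\mathbf{a})=x$. A Pisot number is a real algebraic integer $>1$ all of whose Galois conjugates have modulus strictly less than $1$. *)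

(* Defs.v *)
From HB Require Import structures.
From mathcomp Require Import all_boot all_order all_algebra.
From mathcomp Require Import all_classical all_reals all_analysis.
From mathcomp Require Import complex.
Set Implicit Arguments. Unset Strict Implicit. Unset Printing Implicit Defensive.
Import Order.TTheory GRing.Theory Num.Theory numFieldNormedType.Exports.
Local Open Scope ring_scope.
Local Open Scope classical_set_scope.

Section Defs.
Variable R : realType.

Definition ifs_map (n : nat) (lam : R) (p : 'I_n.+1 -> R) (i : 'I_n.+1) (x : R) : R :=
  lam * x + (1 - lam) * p i.

Definition ifs_partial (n : nat) (lam : R) (p : 'I_n.+1 -> R)
  (a : nat -> 'I_n.+1) (j : nat) : R :=
  foldr (fun k x => ifs_map lam p (a k) x) 0 (iota 0 j).

Definition coding_map (n : nat) (lam : R) (p : 'I_n.+1 -> R)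
  (a : nat -> 'I_n.+1) : R :=
  limn (ifs_partial lam p a).

Definition universal (n : nat) (a : nat -> 'I_n.+1) : Prop :=
  forall w : seq 'I_n.+1, exists k : nat,
    forall m : nat, (m < size w)%N -> a (k + m)%N = nth ord0 w m.

Definition X_uni (n : nat) (lam : R) (p : 'I_n.+1 -> R) (X : set R) : set R :=
  [set x | X x /\ exists a : nat -> 'I_n.+1,
             universal a /\ coding_map lam p a = x].

Definition is_attractor (n : nat) (lam : R) (p : 'I_n.+1 -> R) (X : set R) : Prop :=
  X !=set0 /\ compact X /\ X = \bigcup_(i in [set: 'I_n.+1]) (ifs_map lam p i @` X).

(* Pisot number: real algebraic integer > 1 whose Galois conjugates (the other
   complex roots of its minimal polynomial over Q) have modulus < 1.  The
   minimal polynomial is represented as a monic integer polynomial that is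
   irreducible over Q (an algebraic number is an algebraic integer iff its
   monic minimal polynomial over Q has integer coefficients). *)
Definition pisot (x : R) : Prop :=
  1 < x /\
  exists q : {poly int},
    q \is monic /\
    irreducible_poly (map_poly (fun z : int => z%:~R : rat) q) /\
    root (map_poly (fun z : int => z%:~R : R) q) x /\
    forall z : R[i], root (map_poly (fun k : int => k%:~R : R[i]) q) z ->
      z != (x%:C)%C -> `|z| < 1.

End Defs.

(* Main.v *)
(* Put b = 1/lambda, and call q separated when 0 is isolated among the values at q
   of the polynomials with coefficients in {-1, 0, 1}.

   Since lambda > 1/2, the attractor is the interval between the extreme points of
   F, and both extreme maps occur in a universal sequence, so it never codes an end
   point.  Conversely, an interior point x gets a universal code by prescribing all
   finite words one after the other, as soon as for every word w it can be written
   S_u S_w x' with x' interior.  If b^m is not separated for some m >= 2 with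
   b^m < 2, the digits of the two extreme maps suffice for this: those of u at the
   positions in m Z give a fine net, because differences of 0/1 sums of powers of
   b^m are arbitrarily small, and the other positions bring x within reach of it.

   A separated q in (1, 2) is a Pisot number.  Indeed the values at q of
   {-1, 0, 1}-polynomials form a finite set in the interval |y| <= 1/(q - 1), which
   gives algebraicity.  For a conjugate z with |z| >= 1, start from a polynomial h
   that is small at q, and repeat h := X h + e with e in {-1, 0, 1}.  One can choose
   the digits e with the sign of Re(w z^-k), while h(q) remains in a finite set;
   then h(z) takes finitely many values but Re(w z^-k h(z)) never decreases.  This
   is absurd if |z| > 1; if |z| = 1 the increments are not summable.

   If theta^3 = theta + 1 and b^2 < theta, then b^2 and b^3 are not both separated:
   otherwise they would be Pisot numbers, and so would b.  But b <= 144/125, and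
   Siegel's argument excludes this: with P the minimal polynomial of b and
   P^*(X) = X^d P(1/X), the series P/P^* has integer coefficients a_n, and
   (1 - b X) P/P^* is X - b times a Blaschke product, so that
   a_0^2 + sum (a_(n+1) - b a_n)^2 < 1 + b^2. *)

Require Import Defs.
From HB Require Import structures.
From mathcomp Require Import all_boot all_order all_algebra separable.
From mathcomp Require Import all_classical all_reals all_analysis.
From mathcomp Require Import complex.
From mathcomp Require Import ring lra zify.
Set Implicit Arguments. Unset Strict Implicit. Unset Printing Implicit Defensive.
Import Order.TTheory GRing.Theory Num.Theory numFieldNormedType.Exports.
Local Open Scope ring_scope.
Local Open Scope classical_set_scope.

(** * Polynomials with digits as coefficients *)

Definition ev (K : comNzRingType) (x : K) (f : {poly int}) : K := (map_poly intr f).[x].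

Section Evaluation.
Variables (K : comNzRingType) (x : K).
Implicit Types f g : {poly int}.

Lemma evD f g : ev x (f + g) = ev x f + ev x g.
Proof. by rewrite /ev rmorphD hornerD. Qed.
Lemma evN f : ev x (- f) = - ev x f.
Proof. by rewrite /ev rmorphN hornerN. Qed.
Lemma evB f g : ev x (f - g) = ev x f - ev x g.
Proof. by rewrite evD evN. Qed.
Lemma evM f g : ev x (f * g) = ev x f * ev x g.
Proof. by rewrite /ev rmorphM hornerM. Qed.
Lemma evC (c : int) : ev x c%:P = c%:~R.
Proof. by rewrite /ev map_polyC hornerC. Qed.
Lemma evX : ev x 'X = x.
Proof. by rewrite /ev map_polyX hornerX. Qed.
Lemma evXn n : ev x 'X^n = x ^+ n.
Proof. by rewrite /ev map_polyXn hornerXn. Qed.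
Lemma ev0 : ev x 0 = 0.
Proof. by rewrite /ev rmorph0 horner0. Qed.
Lemma ev1 : ev x 1 = 1.
Proof. by rewrite /ev rmorph1 hornerC. Qed.
Definition evE := (evD, evN, evM, evC, evX, evXn, ev0, ev1).

Lemma ev_comp f m : ev x (f \Po 'X^m) = ev (x ^+ m) f.
Proof. by rewrite /ev map_comp_poly /= map_polyXn horner_comp hornerXn. Qed.

End Evaluation.

Definition sdig (f : {poly int}) := forall i, `|f`_i| <= 1.
Definition bdig (k : nat) (f : {poly int}) :=
  (size f <= k)%N /\ forall i, 0 <= f`_i <= 1.

Lemma coef_cat (f a : {poly int}) k i : (size a <= k)%N ->
  (f * 'X^k + a)`_i = if (i < k)%N then a`_i else f`_(i - k).
Proof.
move=> sa; rewrite coefD coefMXn; case: ltnP => ik; first by rewrite add0r.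
by rewrite [a`_i]nth_default ?addr0 //; apply: leq_trans sa ik.
Qed.

Lemma sdig_cat f a k : sdig f -> sdig a -> (size a <= k)%N -> sdig (f * 'X^k + a).
Proof. by move=> hf ha sa i; rewrite coef_cat //; case: ifP. Qed.

Lemma sdigN f : sdig f -> sdig (- f).
Proof. by move=> hf i; rewrite coefN normrN. Qed.

Lemma sdigC c : `|c| <= 1 -> sdig c%:P.
Proof. by move=> hc i; rewrite coefC; case: ifP. Qed.

Lemma sdig_cons f e : sdig f -> `|e| <= 1 -> sdig (f * 'X + e%:P).
Proof.
by move=> hf he; apply: (@sdig_cat _ _ 1) => //; [exact: sdigC | exact: size_polyC_leq1].
Qed.

Lemma bdig_cat l k f a : bdig l f -> bdig k a -> bdig (l + k) (f * 'X^k + a).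
Proof.
move=> [sf hf] [sa ha]; split; last first.
  by move=> i; rewrite coef_cat //; case: ifP.
apply: (leq_trans (size_polyD _ _)); rewrite geq_max; apply/andP; split; last first.
  by apply: (leq_trans sa); exact: leq_addl.
have [->|f0] := eqVneq f 0; first by rewrite mul0r size_poly0.
by rewrite size_mulXn // addnC leq_add2r.
Qed.

Lemma bdig0 k : bdig k 0.
Proof. by split => [|i]; rewrite ?size_poly0 ?coef0. Qed.

Lemma bdigC c : 0 <= c <= 1 -> bdig 1 c%:P.
Proof. by move=> hc; split => [|i]; rewrite ?size_polyC_leq1 // coefC; case: ifP. Qed.

Lemma bdig_cons k f e : bdig k f -> 0 <= e <= 1 -> bdig k.+1 (f * 'X + e%:P).
Proof. by move=> hf he; rewrite -addn1; apply: (@bdig_cat k 1) => //; exact: bdigC. Qed.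

Lemma bdig_widen k l f : (k <= l)%N -> bdig k f -> bdig l f.
Proof. by move=> kl [sf hf]; split => //; apply: leq_trans kl. Qed.

Lemma bdigB k l a b : bdig k a -> bdig l b -> sdig (a - b).
Proof. by move=> [_ ha] [_ hb] i; rewrite coefB; move: (ha i) (hb i); move: (a`_i) => x; move: (b`_i) => y; lia. Qed.

Lemma sizeB_leq k (a b : {poly int}) : (size a <= k)%N -> (size b <= k)%N ->
 (size (a - b)%R <= k)%N.
Proof.
by move=> ha hb; apply: (leq_trans (size_polyD _ _)); rewrite geq_max size_polyN ha hb.
Qed.

Lemma sdig_split f : sdig f ->
  exists k a b, [/\ bdig k a, bdig k b & f = a - b].
Proof.
move=> hf; exists (size f).
exists (\poly_(i < size f) Num.max f`_i 0), (\poly_(i < size f) Num.max (- f`_i) 0).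
split.
- split=> [|i]; first exact: size_poly.
  by rewrite coef_poly; move: (hf i); move: (f`_i) => x; case: ifP => // _; lia.
- split=> [|i]; first exact: size_poly.
  by rewrite coef_poly; move: (hf i); move: (f`_i) => x; case: ifP => // _; lia.
apply/polyP => i; rewrite coefB !coef_poly; case: ltnP => hi; first by move: (f`_i) => x; lia.
by rewrite nth_default // subr0.
Qed.

Lemma bdig_split_last k f : bdig k.+1 f ->
  exists a (e : int), [/\ bdig k a, 0 <= e <= 1 & f = e%:P * 'X^k + a].
Proof.
move=> [sf hf]; exists (\poly_(i < k) f`_i), f`_k; split => //.
  split=> [|i]; first exact: size_poly.
  by rewrite coef_poly; case: ifP.
apply/polyP => i; rewrite coefD coefCM coefXn coef_poly.
case: (ltngtP i k) => hik; rewrite ?mulr0 ?mulr1 ?add0r ?addr0 ?hik //.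
by rewrite nth_default //; apply: leq_trans sf hik.
Qed.

(** * Greedy expansions with digits 0 and 1 in a base at most 2 *)

Section Cover.
Variables (R : realType) (q c : R).
Hypotheses (q1 : 1 < q) (q2 : q <= 2) (cE : q * c = c + 1).

(** [cE] says that c is 1/(q - 1), the sum of the q^(-i) for i >= 1; q <= 2 makes it at least 1. *)
Lemma c_ge1 : 1 <= c.
Proof. move: q1 q2 cE => h1 h2 h3; nra. Qed.
Lemma qn_ge1 k : 1 <= q ^+ k.
Proof. exact/exprn_ege1/ltW. Qed.
Lemma qn_gt0 k : 0 < q ^+ k.
Proof. exact/exprn_gt0/(lt_trans _ q1). Qed.

Lemma ev_ge0 k a : bdig k a -> 0 <= ev q a.
Proof.
move=> [_ ha]; rewrite /ev horner_coef; apply: sumr_ge0 => i _.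
rewrite coef_map /= mulr_ge0 // ?ler0z ?exprn_ge0 //; last exact/ltW/(lt_trans _ q1).
by case/andP: (ha i).
Qed.

(* s_k is the sum of the q^i for i < k *)
Local Notation s k := ((q ^+ k - 1) * c).

Lemma s_succ k : s k.+1 = s k + q ^+ k.
Proof. by rewrite exprS mulrBl -mulrA mulrCA cE; ring. Qed.

Lemma cover1 k y : 0 <= y <= s k + 1 ->
  exists a, bdig k a /\ 0 <= y - ev q a <= 1.
Proof.
move: q1 q2 cE => h1 h2 h3; elim: k y => [|k IH] y.
  by rewrite expr0 subrr mul0r add0r => hy; exists 0; rewrite ev0 subr0; split => //; exact: bdig0.
rewrite s_succ => hy.
(* As q <= 2, a power exceeds the sum of the lower ones by at most 1, so that the ranges reached
   with and without the digit at place k overlap. *)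
have hs : q ^+ k <= s k + 1.
  elim: (k) => [|j IHj]; first by rewrite expr0; lra.
  by rewrite s_succ exprS; move: IHj; have := qn_gt0 j; nra.
have [yk|yk] := leP (q ^+ k) y.
  have [|a [ba ha]] := IH (y - q ^+ k); first by lra.
  exists (1 * 'X^k + a); split; last by rewrite !evE; lra.
  by rewrite -add1n; apply: bdig_cat => //; exact: bdigC.
have [|a [ba ha]] := IH y; first by lra.
by exists a; split => //; apply: bdig_widen ba.
Qed.

(** Here q^k c is s_k + c. A target above s_k + 1 is replaced by s_k + 1, which adds at most c - 1
    to the remainder. *)
Lemma cover k y : 0 <= y <= q ^+ k * c ->
  exists a, bdig k a /\ 0 <= y - ev q a <= c.
Proof.
move=> hy; have hc := c_ge1; move: q1 q2 cE => h1 h2 h3.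
have [h|h] := leP y (s k + 1).
  have [|a [ba ha]] := @cover1 k y; first lra.
  by exists a; split => //; lra.
have [|a [ba ha]] := @cover1 k (s k + 1); first by have := qn_ge1 k; nra.
by exists a; split => //; lra.
Qed.

End Cover.

(** * Finiteness of the bounded spectrum of a separated number *)

Definition separated (R : realType) (q : R) :=
  exists2 d : R, 0 < d & forall f, sdig f -> ev q f = 0 \/ d <= `|ev q f|.

(** Pigeonhole: the integer part of (t - z)/d separates the points and takes at most floor(1/d) + 1
    values. *)
Lemma separated_size (R : realType) (d z : R) (s : seq R) : 0 < d -> uniq s ->
  {in s, forall t, z <= t <= z + 1} ->
  {in s &, forall t t', t != t' -> d <= `|t - t'|} ->
  (size s <= (Num.truncn d^-1).+1)%N.
Proof.
move=> d0 us hs sep; pose g t := Num.truncn ((t - z) / d).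
have hg t : t \in s -> (g t)%:R <= (t - z) / d < (g t).+1%:R.
  by move=> /hs ht; apply/truncn_itv/divr_ge0; [lra | exact: ltW].
rewrite -(size_map g) -(size_iota 0 (Num.truncn d^-1).+1).
apply: uniq_leq_size.
  rewrite map_inj_in_uniq // => t t' ts t's gtt'; apply/eqP/negPn/negP => /(sep _ _ ts t's).
  have := hg _ ts; have := hg _ t's; rewrite gtt' !ler_pdivlMr // !ltr_pdivrMr // -natr1.
  rewrite mulrDl mul1r => h1 h2; apply/negP; rewrite -ltNge ltr_norml; lra.
move=> k /mapP[t ts ->]; rewrite mem_iota /= add0n ltnS /g.
apply: le_truncn; rewrite ler_pdivrMr // mulVf ?gt_eqF //.
by have := hs _ ts; lra.
Qed.

Section Window.
Variables (R : realType) (q : R).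
Hypotheses (q1 : 1 < q) (sepq : separated q).

Let win (m : nat) := exists (z : R) (s : seq R),
  [/\ uniq s, size s = m, {in s, forall t, z <= t <= z + 1} &
      {in s, forall t, exists k a, bdig k a /\ t = ev q a}].

Let win1 : win 1.
Proof.
exists 0, [:: 0]; split => // t; rewrite inE => /eqP ->; first lra.
by exists 0%N, 0; rewrite ev0; split => //; exact: bdig0.
Qed.

(* Take a window of length 1 with the largest number of points of A, the set of
   values of 0/1 polynomials; they are values of polynomials of size <= n.
   Translated by q^n v with v in A, they are again points of A, and maximality
   forbids any other point in the translated window. *)
Lemma maximal_window : exists (n : nat) (z : R) (s : seq R), -1 <= z /\
  forall k l u v, bdig k u -> bdig l v ->
    z <= ev q u - q ^+ n * ev q v <= z + 1 -> ev q u - q ^+ n * ev q v \in s.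
Proof.
have [d d0 sep] := sepq.
have ex : exists m, `[< win m >] by exists 1%N; apply/asboolP; exact: win1.
have ub m : `[< win m >] -> (m <= (Num.truncn d^-1).+1)%N.
  move=> /asboolP[z [s [us <- hs hA]]]; apply: (separated_size (z := z)) => //.
  move=> t t' /hA[k [a [ba ->]]] /hA[l [b [bb ->]]]; rewrite -subr_eq0 -evB => ne0.
  by have [/eqP h|] := sep _ (bdigB ba bb) => //; rewrite h in ne0.
case: (ex_maxnP ex ub) => m /asboolP[z [s [us sm hs hA]]] mmax.
have m0 : (0 < m)%N by apply: mmax; apply/asboolP; exact: win1.
have [n hn] : exists n, {in s, forall t, exists a, bdig n a /\ t = ev q a}.
  elim: (s) hA => [|t r IH] hA; first by exists 0%N.
  have [|n hn] := IH; first by move=> t' t'r; apply: hA; rewrite inE t'r orbT.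
  have [k [a [ba ta]]] := hA t (mem_head _ _).
  exists (maxn k n) => t'; rewrite inE => /orP[/eqP ->|/hn[b [bb ->]]].
    by exists a; split => //; apply: bdig_widen ba; exact: leq_maxl.
  by exists b; split => //; apply: bdig_widen bb; exact: leq_maxr.
exists n, z, s; split.
  have : nth 0 s 0 \in s by rewrite mem_nth // sm.
  move=> /[dup] /hs h1 /hn[a [ba]] ea; have := ev_ge0 q1 ba; rewrite -ea; lra.
move=> k l u v bu bv; set t := _ - _ => ht; apply/negPn/negP => tns.
suff : (m.+1 <= m)%N by rewrite ltnn.
apply: mmax; apply/asboolP; exists (z + q ^+ n * ev q v).
exists [seq q ^+ n * ev q v + x | x <- t :: s]; split.
- by rewrite map_inj_uniq /= ?tns // => x y /addrI.
- by rewrite size_map /= sm.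
- move=> _ /mapP[x xs ->]; suff : z <= x <= z + 1 by lra.
  by move: xs; rewrite inE => /orP[/eqP ->//|/hs].
- move=> _ /mapP[x xs ->]; move: xs; rewrite inE => /orP[/eqP ->|/hn[a [ba ->]]].
    by exists k, u; split => //; rewrite /t addrC subrK.
  exists (l + n)%N, (v * 'X^n + a); split; first exact: bdig_cat.
  by rewrite !evE mulrC.
Qed.

End Window.

Fixpoint bdig_values (R : realType) (q : R) (k : nat) : seq R :=
  if k is k'.+1 then bdig_values q k' ++ [seq q ^+ k' + x | x <- bdig_values q k']
  else [:: 0].

Lemma bdig_valuesP (R : realType) (q : R) k a : bdig k a -> ev q a \in bdig_values q k.
Proof.
elim: k a => [|k IH] a ha /=.
  case: ha; rewrite leqn0 size_poly_eq0 => /eqP -> _.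
  by rewrite ev0 inE.
have [b [e [/IH bb he ->]]] := bdig_split_last ha; rewrite mem_cat.
have [->|->] : e = 0 \/ e = 1 by lia.
  by rewrite mul0r add0r bb.
by apply/orP; right; rewrite !evE mul1r; apply: map_f.
Qed.

Lemma expr_unbounded (R : realType) (q M : R) : 1 < q -> exists k, M <= q ^+ k.
Proof.
move=> q1; have [k hk] : exists k, `|M| / (q - 1) <= k%:R.
  exists (Num.truncn (`|M| / (q - 1))).+1; apply/ltW/truncnS_gt.
exists k; move: hk; rewrite ler_pdivrMr ?subr_gt0 // => hk.
have : 1 + k%:R * (q - 1) <= q ^+ k.
  elim: (k) => [|j IH]; first by rewrite mul0r addr0.
  rewrite exprS -natr1; have : 0 <= (j%:R : R) * (q - 1) ^+ 2 by rewrite mulr_ge0 ?sqr_ge0.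
  by move: IH; nra.
by have := ler_norm M; lra.
Qed.

Section Finiteness.
Variables (R : realType) (q c : R).
Hypotheses (q1 : 1 < q) (q2 : q <= 2) (cE : q * c = c + 1) (sepq : separated q).

(** Write d = u(q) - v(q) and append 0/1 tails a to u and b to v so that t, a difference of extended
    values, falls into the maximal window. Finitely many t and tails remain, and they determine d.
    Since r < c, some k has q^k r + 1 <= (q^k - 1) c, which gives the tails enough range. *)
Lemma finite_spectrum_inside (r : R) : 0 <= r < c ->
  exists S : seq R, forall f, sdig f -> `|ev q f| <= r -> ev q f \in S.
Proof.
move=> hr; have [n [z [s [z1 hs]]]] := maximal_window q1 sepq.
have [k hk] := expr_unbounded ((1 + c) / (c - r) + z + 3 + 2 * q ^+ n) q1.
have c1 := c_ge1 q1 q2 cE.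
have k1 : q ^+ k * r + 1 <= (q ^+ k - 1) * c.
  have : (1 + c) / (c - r) <= q ^+ k by have := qn_gt0 q1 n; lra.
  by rewrite ler_pdivrMr; lra.
have k2 : z + 1 + 2 * q ^+ n <= (q ^+ (n + k) - 1) * c + 1.
  have h1 : 0 <= (1 + c) / (c - r) by apply: divr_ge0; lra.
  have h2 := qn_ge1 q1 n; have h3 := qn_ge1 q1 k; rewrite exprD.
  have h4 : q ^+ k <= q ^+ n * q ^+ k by nra.
  have h5 : q ^+ n * q ^+ k - 1 <= (q ^+ n * q ^+ k - 1) * c by nra.
  lra.
pose S := [seq (x.1 + q ^+ n * x.2.1 - x.2.2) / q ^+ (n + k) |
  x <- [seq (t, w) | t <- s, w <- [seq (b, a) | b <- bdig_values q k, a <- bdig_values q (n + k)]]].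
have main f : sdig f -> 0 <= ev q f <= r -> ev q f \in S.
  move=> /sdig_split[l [u [v [bu bv ->]]]]; rewrite evB; set d := _ - _ => hd.
  have Qk := qn_ge1 q1 k; have Qn := qn_ge1 q1 n.
  (* The summand 2 puts [ev q b - q ^+ k * d] into [1, 2]; with z >= -1 this makes T nonnegative,
     and [k2] bounds it above. *)
  have [|b [bb hb]] := cover1 q1 q2 cE (k := k) (y := q ^+ k * d + 2); first by nra.
  pose T := z + 1 - q ^+ (n + k) * d + q ^+ n * ev q b.
  have hT : T = z + 1 + q ^+ n * (ev q b - q ^+ k * d) by rewrite /T exprD; ring.
  have [|a [ba ha]] := cover1 q1 q2 cE (k := n + k) (y := T); first by rewrite hT; nra.
  pose t := ev q (u * 'X^(n + k) + a) - q ^+ n * ev q (v * 'X^k + b).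
  have tE : t = z + 1 - (T - ev q a) by rewrite /t /T !evE /d exprD; ring.
  have ts : t \in s.
    by apply: (hs (l + (n + k))%N (l + k)%N); [exact: bdig_cat..|rewrite -/t tE; lra].
  apply/mapP; exists (t, (ev q b, ev q a)).
    apply: allpairs_f => //; apply: allpairs_f; exact: bdig_valuesP.
  rewrite /= tE /T; field.
  by rewrite expf_neq0 // gt_eqF // (lt_trans _ q1).
exists (S ++ [seq - x | x <- S]) => f hf hfr; rewrite mem_cat.
have [f0|f0] := leP 0 (ev q f).
  by rewrite main // f0 /=; move: hfr; rewrite ger0_norm.
apply/orP; right; apply/mapP; exists (ev q (- f)); last by rewrite evN opprK.
apply: main; first exact: sdigN.
by rewrite evN; move: hfr; rewrite ltr0_norm //; lra.
Qed.

Lemma int_abs_le1 (e : int) : `|e| <= 1 -> e = -1 \/ e = 0 \/ e = 1.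
Proof. by move=> he; lia. Qed.

Lemma sdig_last f : sdig f -> exists g (e : int), [/\ sdig g, `|e| <= 1,
   f = g * 'X + e%:P & (size g <= (size f).-1)%N].
Proof.
move=> hf; exists (\poly_(i < (size f).-1) f`_i.+1), f`_0; split => //.
- by move=> i; rewrite coef_poly; case: ifP.
- apply/polyP => i; rewrite coefD coefMX coefC coef_poly; case: i => [|i] /=; first by rewrite add0r.
  rewrite addr0; case: ltnP => // hi; rewrite nth_default //; lia.
Qed.

(* Points of the spectrum above c/q arise from lower ones by steps y -> q y - 1,
   which multiply the distance to c by q. *)
Lemma finite_spectrum :
  exists S : seq R, forall f, sdig f -> `|ev q f| <= c -> ev q f \in S.
Proof.
have c1 := c_ge1 q1 q2 cE.
pose r := c / q; have rE : r = c - 1 / q.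
  by rewrite /r -[c in LHS](addrK 1) -cE; field; rewrite gt_eqF // (lt_trans _ q1).
have qp : 0 < q := lt_trans ltr01 q1.
have qi : q * (1 / q) = 1 by field; rewrite gt_eqF.
have ci : c * (1 / q) = c - 1 / q.
  move: (1 / q) qi => i hi; have : i * (q * c) = i * (c + 1) by rewrite cE.
  by rewrite mulrA [i * q]mulrC hi; lra.
have q0 : 0 < 1 / q by rewrite divr_gt0 // (lt_trans _ q1).
have i1 : 1 / q < 1 by rewrite ltr_pdivrMr ?mul1r // (lt_trans _ q1).
have [|S hS] := @finite_spectrum_inside r; first by lra.
pose T := [seq x <- [seq q * x + e%:~R | x <- S, e <- [:: -1; 0; 1 : int]] | x < c].
have [eta eta0 heta] : exists2 eta, 0 < eta & {in T, forall x, eta <= c - x}.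
  have : {in T, forall x, x < c} by move=> x; rewrite mem_filter => /andP[].
  elim: (T) => [|x t IH] ht; first by exists 1.
  have [|eta eta0 heta] := IH; first by move=> y yt; apply: ht; rewrite inE yt orbT.
  have xc := ht x (mem_head _ _).
  exists (Num.min eta (c - x)); first by rewrite lt_min eta0 subr_gt0.
  move=> y; rewrite inE => /orP[/eqP ->|/heta hy]; rewrite ge_min ?lexx ?orbT //.
  by rewrite hy.
have key f : sdig f -> r < ev q f <= c ->
    ev q f = c \/ exists2 x, x \in T & exists j, ev q f = c - q ^+ j * (c - x).
  have [m hm] := ubnP (size f); elim: m f hm => // m IH f hm hf hc.
  have [g [e [hg he fE sg]]] := sdig_last hf.
  have evf : ev q f = q * ev q g + e%:~R by rewrite fE !evE mulrC.
  have [gr|gr] := leP `|ev q g| r.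
    have [->|fc] := eqVneq (ev q f) c; [by left|right].
    exists (ev q f); last by exists 0%N; rewrite expr0; ring.
    rewrite mem_filter; apply/andP; split.
      by rewrite lt_neqAle fc; case/andP: hc.
    rewrite evf.
    apply/allpairsPdep; exists (ev q g), e; split => //=; first exact: hS.
    by have [->|[->|->]] := int_abs_le1 he.
  have [ee|[ee|ee]] := int_abs_le1 he.
  - move: evf; rewrite ee mulrN1z => evf.
    have gr' : r < ev q g <= c.
      have g0 : 0 < ev q g by rewrite -(pmulr_rgt0 _ qp); lra.
      move: gr; rewrite gtr0_norm // => ->.
      by rewrite -(ler_pM2l qp) cE; lra.
    have sg' : (size g < m)%N.
      have : f != 0 by apply/negP => /eqP f0; move: hc; rewrite f0 ev0; lra.
      by rewrite -size_poly_gt0 => f0; rewrite (leq_ltn_trans sg) // prednK.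
    have [gc|[x xT [j gx]]] := IH g sg' hg gr'.
      by left; rewrite evf gc cE; ring.
    right; exists x => //; exists j.+1; rewrite evf gx exprS mulrBr cE; ring.
  - exfalso; move: evf; rewrite ee addr0 => evf.
    have : ev q g = ev q f * (1 / q) by rewrite evf mulrAC qi mul1r.
    move: gr; rewrite ltNge ler_norml => /negP gr gE; apply: gr; rewrite gE rE.
    have := ler_pM2r q0 (ev q f) c; have := pmulr_lgt0 (ev q f) q0; lra.
  - exfalso; move: evf; rewrite ee => evf.
    have : ev q g = (ev q f - 1) * (1 / q) by rewrite evf addrK mulrAC qi mul1r.
    move: gr; rewrite ltNge ler_norml => /negP gr gE; apply: gr; rewrite gE rE mulrBl mul1r.
    have : c * (1 / 2) <= c * (1 / q).
      by rewrite ler_pM2l ?(lt_le_trans ltr01) // !mul1r lef_pV2 ?posrE.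
    have := ler_pM2r q0 (ev q f) c; have := pmulr_lgt0 (ev q f) q0; lra.
(* After more than J steps the distance to c would exceed c, and the value would be negative. *)
have [J hJ] := expr_unbounded (c / eta) q1.
pose U := S ++ c :: [seq c - q ^+ j * (c - x) | x <- T, j <- iota 0 J.+1].
have main f : sdig f -> 0 <= ev q f <= c -> ev q f \in U.
  move=> hf hc; rewrite mem_cat inE.
  have [fr|fr] := leP (ev q f) r; first by rewrite hS // ger0_norm //; lra.
  have [|->|[x xT [j hj]]] := key f hf; first lra.
    by rewrite eqxx orbT.
  apply/orP; right; apply/orP; right; rewrite hj; apply/allpairsPdep; exists x, j; split => //.
  rewrite mem_iota /= add0n ltnS leqNgt; apply/negP => Jj.
  have : q ^+ J < q ^+ j by rewrite ltr_eXn2l.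
  have := heta _ xT; move: hJ; rewrite ler_pdivrMr // => h1 h2 h3.
  have : q ^+ J * eta < q ^+ j * (c - x) by have := qn_gt0 q1 J; nra.
  have : 0 < r by rewrite rE; move: q1 q2; nra.
  by move: fr; rewrite hj; lra.
exists (U ++ [seq - x | x <- U]) => f hf hfc; rewrite mem_cat.
have [f0|f0] := leP 0 (ev q f).
  by rewrite main // f0 /=; move: hfc; rewrite ger0_norm.
apply/orP; right; apply/mapP; exists (ev q (- f)); last by rewrite evN opprK.
apply: main; first exact: sdigN.
by rewrite evN; move: hfc; rewrite ltr0_norm //; lra.
Qed.

End Finiteness.

(** * Separated numbers are Pisot numbers *)

Section Algebraicity.
Variables (R : realType) (q c : R).
Hypotheses (q1 : 1 < q) (q2 : q <= 2) (cE : q * c = c + 1) (sepq : separated q).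

(** The digit opposes the sign of the value, which keeps the value in [-c, c]. Two terms of
    different degrees with the same value at q then give a monic equation. *)
Fixpoint bounded_orbit (k : nat) : {poly int} :=
  if k is k'.+1 then
    let f := bounded_orbit k' in
    f * 'X + (if 0 <= ev q f then -1 else 1)%:P
  else 1.

Lemma bounded_orbitP k :
  [/\ sdig (bounded_orbit k), `|ev q (bounded_orbit k)| <= c,
      bounded_orbit k \is monic & size (bounded_orbit k) = k.+1].
Proof.
have c1 := c_ge1 q1 q2 cE; move: q1 q2 cE => h1 h2 h3.
elim: k => [|k [IH1 IH2 IH3 IH4]] /=.
  by rewrite ev1 normr1 size_poly1 monic1; split => //; exact: sdigC.
have sE e : size (bounded_orbit k * 'X + e%:P) = k.+2.
  by rewrite size_MXaddC IH4 -size_poly_eq0 IH4 /=.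
split => //.
- by apply: sdig_cons => //; case: ifP.
- have q0 : 0 < q := lt_trans ltr01 q1.
  move: IH2; rewrite !evE !ler_norml; move: (ev q _) => y /andP[l u].
  have {}l : - c * q <= y * q by rewrite ler_pM2r.
  have {}u : y * q <= c * q by rewrite ler_pM2r.
  case: (leP 0 y) => h; first by have := mulr_ge0 h (ltW q0); rewrite mulrN1z; lra.
  by have := nmulr_rlt0 q h; rewrite q0 mulr1z; lra.
- rewrite monicE lead_coefE sE /= coefD coefMX coefC /= addr0.
  by move: IH3; rewrite monicE lead_coefE IH4.
Qed.

Lemma separated_algebraic : exists2 P : {poly int}, P \is monic & ev q P = 0.
Proof.
have [S hS] := finite_spectrum q1 q2 cE sepq.
pose L := [seq ev q (bounded_orbit k) | k <- iota 0 (size S).+1].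
have : ~~ uniq L.
  apply/negP => uL; have : (size L <= size S)%N.
    apply: uniq_leq_size => // _ /mapP[k _ ->].
    by have [h1 h2 _ _] := bounded_orbitP k; exact: hS.
  by rewrite size_map size_iota ltnn.
move=> /(uniqPn 0)[i [j [ij]]]; rewrite size_map size_iota => jS.
rewrite !(nth_map 0%N) ?size_iota // ?(ltn_trans ij) // !nth_iota // ?(ltn_trans ij) // !add0n => e.
exists (bounded_orbit j - bounded_orbit i); last by rewrite evB e subrr.
have [_ _ mj sj] := bounded_orbitP j; have [_ _ _ si] := bounded_orbitP i.
by rewrite monicE lead_coefDl ?size_polyN ?sj ?si // -monicE.
Qed.

End Algebraicity.

(** * Minimal polynomials and conjugates *)

Lemma evZQ (K : numFieldType) (x : K) (f : {poly int}) :
  ev x f = (map_poly (ratr : rat -> K) (map_poly intr f)).[x].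
Proof.
rewrite /ev -map_poly_comp; congr (_.[x]); apply: eq_map_poly => z /=.
by rewrite ratr_int.
Qed.

(** Take a monic integer polynomial of least degree vanishing at x. By Gauss's lemma a rational
    factor comes from an integer one with leading coefficient 1 or -1, to which minimality
    applies. *)
Lemma monic_irreducible_factor (K : numFieldType) (x : K) (P : {poly int}) :
  P \is monic -> ev x P = 0 ->
  exists Q : {poly int}, [/\ Q \is monic, irreducible_poly (map_poly intr Q : {poly rat})
                           & ev x Q = 0].
Proof.
move=> mP xP.
pose A n := `[< exists Q : {poly int}, [/\ Q \is monic, ev x Q = 0 & size Q = n] >].
have exA : exists n, A n by exists (size P); apply/asboolP; exists P.
case: (ex_minnP exA) => n /asboolP[Q [mQ xQ sQ]] nmin.
have Q0 : Q != 0 by apply: monic_neq0.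
have small f : ev x f = 0 -> `|lead_coef f| = 1 -> (n <= size f)%N.
  move=> xf; have [lf|lf] := leP 0 (lead_coef f) => l1.
    by apply: nmin; apply/asboolP; exists f; rewrite monicE -l1 ger0_norm.
  apply: nmin; apply/asboolP; exists (- f); split; last by rewrite size_polyN.
    by rewrite monicE lead_coefN -l1 ltr0_norm.
  by rewrite evN xf oppr0.
exists Q; split => //.
have sz : size (map_poly intr Q : {poly rat}) = n.
  by rewrite size_map_inj_poly // => a b /intr_inj.
split.
  rewrite sz ltnNge; apply/negP => n1; have := size1_polyC (_ : (size Q <= 1)%N).
  rewrite sQ => /(_ n1) Qc; move: mQ xQ; rewrite Qc evC monicE lead_coefC => /eqP ->.
  by move/eqP; rewrite oner_eq0.
move=> p sp /dvdpP_rat_int[p1 [a a0 pE] [r QE]].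
have lr : `|lead_coef p1| = 1 /\ `|lead_coef r| = 1.
  have : lead_coef p1 * lead_coef r = 1 by rewrite -lead_coefM -QE; apply/eqP.
  move: (lead_coef p1) (lead_coef r) => u v huv.
  have : (`|u|%N * `|v|%N = 1)%N by rewrite -abszM huv.
  move/eqP; rewrite muln_eq1 => /andP[]; lia.
have p10 : p1 != 0 by apply: contraNneq Q0 => h; rewrite QE h mul0r.
have r0 : r != 0 by apply: contraNneq Q0 => h; rewrite QE h mulr0.
have sQE : n = (size p1 + size r).-1 by rewrite -sQ QE size_mul.
have sp1 : size p = size p1.
  by rewrite pE size_scale // size_map_inj_poly // => ? ? /intr_inj.
move/eqP : xQ; rewrite QE evM mulf_eq0 => /orP[/eqP xp|/eqP xr].
  have := small _ xp lr.1 => hn.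
  rewrite -dvdp_size_eqp; last first.
    rewrite pE dvdpZl // rmorphM; exact: dvdp_mulr.
  rewrite -QE sz sp1 eqn_leq hn andbT sQE.
  by move: hn r0; rewrite -size_poly_gt0 sQE; lia.
have := small _ xr lr.2 => hn; exfalso; move: sp; rewrite sp1.
by move: hn p10; rewrite -size_poly_gt0 sQE; lia.
Qed.

(** Were Q and f coprime over the rationals, a Bézout relation evaluated at x would read 0 = 1;
    hence Q divides f. *)
Lemma conjugate_root (K K' : numFieldType) (x : K) (z : K') (Q f : {poly int}) :
  irreducible_poly (map_poly intr Q : {poly rat}) ->
  ev x Q = 0 -> ev z Q = 0 -> ev x f = 0 -> ev z f = 0.
Proof.
move=> irr xQ zQ xf; pose Q' : {poly rat} := map_poly intr Q.
pose f' : {poly rat} := map_poly intr f.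
have [/Bezout_eq1_coprimepP[[u v] /= uv]|] := boolP (coprimep Q' f').
  have := congr1 (fun p => (map_poly (ratr : rat -> K) p).[x]) uv.
  rewrite rmorphD !rmorphM rmorph1 hornerD !hornerM hornerC -!evZQ xQ xf !mulr0 addr0.
  by move/esym/eqP; rewrite oner_eq0.
rewrite irreducible_poly_coprime // negbK => /dvdpP[g /(congr1 (map_poly (ratr : rat -> K')))].
by rewrite rmorphM => e; rewrite evZQ e hornerM -evZQ zQ mulr0.
Qed.

(** * Linking two points of an interval by short steps *)

Lemma chain_step (R : realType) (a b c x : R) (m n : int) :
  0 < a -> 0 < b -> a + b <= c -> 0 <= x <= c ->
  0 <= x + (m%:~R * a + n%:~R * b) <= c -> (m, n) <> (0, 0) ->
  exists i j : int, [/\ (i, j) \in [:: (1, 0); (-1, 0); (0, 1); (0, -1)],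
     0 <= x + (i%:~R * a + j%:~R * b) <= c &
     (absz (m - i) + absz (n - j) < absz m + absz n)%N].
Proof.
move=> a0 b0 abc xc yc mn0.
have ge1 (p : int) : 0 < p -> 1 <= (p%:~R : R) by move=> p0; rewrite ler1z; lia.
have len1 (p : int) : p < 0 -> (p%:~R : R) <= -1 by move=> p0; rewrite -[-1]/((-1)%:~R) ler_int; lia.
have ge0 (p : int) : 0 <= p -> 0 <= (p%:~R : R) by rewrite ler0z.
have le0 (p : int) : p <= 0 -> (p%:~R : R) <= 0 by rewrite lerz0.
(* If the step by a towards the target leaves [0, c], then a + b <= c leaves room for a step by b in
   the opposite direction, and n has the sign that makes this progress. *)
have [m0|m0|m0] := ltgtP m 0.
- have [xa|xa] := leP a x.
    by exists (-1), 0; split; [by []|rewrite mulrN1z mulr0z; lra|lia].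
  have n0 : 0 < n.
    rewrite ltNge; apply/negP => /le0 n0; have := len1 _ m0; nra.
  by exists 0, 1; split; [by []|rewrite mulr1z mulr0z; lra|lia].
- have [xa|xa] := leP (x + a) c.
    by exists 1, 0; split; [by []|rewrite mulr1z mulr0z; lra|lia].
  have n0 : n < 0.
    rewrite ltNge; apply/negP => /ge0 n0; have := ge1 _ m0; nra.
  by exists 0, (-1); split; [by []|rewrite mulrN1z mulr0z; lra|lia].
rewrite m0 mulr0z mul0r add0r in yc.
have [n0|n0|n0] := ltgtP n 0.
- exists 0, (-1); split; [by []|have := len1 _ n0; rewrite mulrN1z mulr0z; nra|lia].
- exists 0, 1; split; [by []|have := ge1 _ n0; rewrite mulr1z mulr0z; nra|lia].
by exfalso; apply: mn0; rewrite m0 n0.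
Qed.

(** The integers m and n are arbitrary, so this need not be a digit polynomial even if v is one; its
    |m| + |n| summands v and X v, up to sign, then are. *)
Definition two_step (v : {poly int}) (m n : int) : {poly int} :=
  (m%:P + n%:P * 'X) * v.

Lemma two_step_sdig v i j : sdig v ->
  (i, j) \in [:: (1, 0); (-1, 0); (0, 1); (0, -1)] -> sdig (two_step v i j).
Proof.
move=> hv; rewrite /two_step.
have hvX : sdig ('X * v).
  by have := sdig_cons hv (_ : `|0| <= 1); rewrite polyC0 addr0 mulrC; apply.
rewrite !inE => /or4P[] /eqP[-> ->].
- by rewrite mul0r addr0 mul1r.
- by rewrite mul0r addr0 polyCN mulN1r; exact: sdigN.
- by rewrite add0r mul1r.
by rewrite add0r polyCN mulN1r mulNr; exact: sdigN.
Qed.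

Section Chains.
Variables (R : realType) (q c : R).
Hypotheses (q1 : 1 < q) (q2 : q <= 2) (cE : q * c = c + 1) (sepq : separated q).
Variables (v : {poly int}).
Hypotheses (hv : sdig v) (v0 : 0 < ev q v) (v1 : (1 + q) * ev q v <= 1).

Let hE m n : ev q (two_step v m n) = m%:~R * ev q v + n%:~R * (q * ev q v).
Proof. by rewrite /two_step !evE; ring. Qed.

(* Two points of [0, c] differing by (m + n q) v are linked inside [0, c] by
   |m| + |n| steps +-v, +-q v; each step has a finite number of images. *)
Lemma finite_differences (N : nat) : exists S : seq R, forall m n,
  (absz m + absz n <= N)%N -> forall k a b x, bdig k a -> bdig k b ->
  0 <= x <= c -> 0 <= x + ev q (two_step v m n) <= c ->
  0 <= q ^+ k * x - ev q a <= c ->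
  0 <= q ^+ k * (x + ev q (two_step v m n)) - ev q b <= c ->
  ev q ('X^k * two_step v m n + a - b) \in S.
Proof.
have [V hV] := finite_spectrum q1 q2 cE sepq.
have zero k a b x : bdig k a -> bdig k b -> 0 <= q ^+ k * x - ev q a <= c ->
    0 <= q ^+ k * (x + ev q (two_step v 0 0)) - ev q b <= c ->
    ev q ('X^k * two_step v 0 0 + a - b) \in V.
  move=> ba bb; rewrite /two_step mul0r addr0 mul0r mulr0 add0r ev0 addr0 => ha hb.
  by apply: hV; [exact: bdigB ba bb|rewrite ler_norml !evE; lra].
elim: N => [|N [S hS]].
  exists V => m n; rewrite leqn0 addn_eq0 !absz_eq0 => /andP[/eqP -> /eqP ->].
  by move=> k a b x ba bb _ _; exact: zero.
exists (V ++ [seq y + t | y <- V, t <- S]) => m n hmn k a b x ba bb hx hxh ha hb.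
rewrite mem_cat; have [[m0 n0]|mn0] := eqVneq (m, n) (0, 0).
  by move: hb; rewrite m0 n0 => hb; rewrite (zero _ _ _ x).
apply/orP; right; have q0 : 0 < q := lt_trans ltr01 q1; have c1 := c_ge1 q1 q2 cE.
have [||||||i [j [ij hx1 mnij]]] := @chain_step _ (ev q v) (q * ev q v) c x m n => //.
- exact: mulr_gt0.
- by have h := v1; lra.
- by rewrite -hE.
- by apply/eqP.
pose x1 := x + ev q (two_step v i j).
have hx1' : 0 <= x1 <= c by rewrite /x1 hE.
have [|a1 [ba1 ha1]] := cover q1 q2 cE (k := k) (y := q ^+ k * x1).
  have qk := qn_gt0 q1 k; case/andP: hx1' => xa xb.
  by rewrite mulr_ge0 ?ler_pM2l // ltW.
(* The expansion a1 of the intermediate point x1 ends the first step and starts the remaining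
   chain. *)
have split : 'X^k * two_step v m n + a - b =
    ('X^k * two_step v i j + a - a1) + ('X^k * two_step v (m - i) (n - j) + a1 - b).
  rewrite /two_step !polyCB; ring.
rewrite split evD; apply/allpairsPdep; do 2 eexists; split; last by reflexivity.
  apply: hV; last first.
    by rewrite ler_norml evB evD evM evXn; move: ha ha1; rewrite /x1 mulrDr; lra.
  rewrite -addrA ['X^k * _]mulrC; apply: sdig_cat.
  - exact: two_step_sdig.
  - exact: bdigB ba ba1.
  - by apply: sizeB_leq; [case: ba|case: ba1].
have e1 : x1 + ev q (two_step v (m - i) (n - j)) = x + ev q (two_step v m n).
  rewrite /x1 !hE !intrB; ring.
apply: (hS _ _ _ _ _ _ x1) => //.
- by rewrite -ltnS; apply: leq_trans hmn.
- by rewrite e1.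
- by rewrite e1.
Qed.

End Chains.

(** * A small positive element of the spectrum *)

Section SmallElement.
Variables (R : realType) (q c : R).
Hypotheses (q1 : 1 < q) (q2 : q < 2) (cE : q * c = c + 1).

(* one_orbit k is X^k - X^(k-1) - ... - 1. *)
Fixpoint one_orbit (k : nat) : {poly int} :=
  if k is k'.+1 then one_orbit k' * 'X + (-1)%:P else 1.

Lemma one_orbit_sdig k : sdig (one_orbit k).
Proof. by elim: k => [|k IH] /=; [exact: sdigC|exact: sdig_cons]. Qed.

Lemma ev_one_orbit (K : comNzRingType) (x : K) k :
  ev x (one_orbit k.+1) = ev x (one_orbit k) * x - 1.
Proof. by rewrite /= !evE mulrN1z. Qed.

(** The orbit of 1 under y -> q y - 1 recedes downwards from c > 1. Let y be the term before the
    first nonpositive one. If y > 1/(1 + q), then 1 - q y < 1/(1 + q); so y or 1 - q y is the small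
    element, unless q y = 1. *)
Lemma small_spectrum_element :
  (exists v, [/\ sdig v, 0 < ev q v & (1 + q) * ev q v <= 1]) \/
  (exists k, ev q (one_orbit k.+1) = 0 /\ forall j, (j <= k)%N -> 0 < ev q (one_orbit j)).
Proof.
move: (q1) (q2) (cE) => h1 h2 h3.
have c1 : 1 < c by nra.
have xE k : c - ev q (one_orbit k) = q ^+ k * (c - 1).
  elim: k => [|k IH]; first by rewrite ev1 expr0 mul1r.
  by rewrite ev_one_orbit exprS -mulrA -IH mulrBr cE; ring.
have exP : exists k, ev q (one_orbit k) <= 0.
  have [k hk] := expr_unbounded (c / (c - 1)) q1; exists k.
  by move: hk; rewrite ler_pdivrMr ?subr_gt0 // -xE; lra.
case: (ex_minnP exP) => -[|k] xk kmin; first by move: xk; rewrite ev1; lra.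
have pos j : (j <= k)%N -> 0 < ev q (one_orbit j).
  by move=> jk; rewrite ltNge; apply/negP => /kmin; rewrite ltnNge jk.
have xk0 := pos k (leqnn k); move: (xk); rewrite ev_one_orbit => xk'.
have [sm|sm] := leP ((1 + q) * ev q (one_orbit k)) 1.
  by left; exists (one_orbit k); split => //; exact: one_orbit_sdig.
have [x0|x0] := eqVneq (ev q (one_orbit k.+1)) 0; first by right; exists k.
left; exists (- one_orbit k.+1); split; first exact/sdigN/one_orbit_sdig.
  by rewrite evN oppr_gt0 lt_neqAle x0.
rewrite evN ev_one_orbit; nra.
Qed.

End SmallElement.

(** * Complex moduli and real parts *)

Notation cmod := Normc.normc.
Notation cre := complex.Re.

Section Modulus.
Variable R : realType.
Implicit Types z w : R[i].

Lemma cmodE z : `|z| = (cmod z)%:C%C. Proof. by case: z. Qed.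

Lemma cmodM z w : cmod (z * w) = cmod z * cmod w.
Proof. exact: Normc.normcM. Qed.

Lemma cmod_ge0 z : 0 <= cmod z.
Proof. by case: z => a b; exact: sqrtr_ge0. Qed.

Lemma cmod_eq0 z : (cmod z == 0) = (z == 0).
Proof. by apply/eqP/eqP => [/Normc.eq0_normc|->] //; exact: Normc.normc0. Qed.

Lemma cmodX z k : cmod (z ^+ k) = cmod z ^+ k.
Proof. by elim: k => [|k IH]; rewrite ?expr0 ?Normc.normc1 // !exprS cmodM IH. Qed.

Lemma ler_cmodD z w : cmod (z + w) <= cmod z + cmod w.
Proof. exact: le_normcD. Qed.

Lemma cmodN z : cmod (- z) = cmod z.
Proof. exact: normcN. Qed.

Lemma cmod_real (a : R) : cmod a%:C%C = `|a|.
Proof. by rewrite /= expr0n /= addr0 sqrtr_sqr. Qed.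

Lemma cre_le_cmod z : cre z <= cmod z.
Proof.
have := normc_ge_Re z; rewrite cmodE lecR; apply: le_trans; exact: ler_norm.
Qed.

Lemma creD z w : cre (z + w) = cre z + cre w.
Proof. by case: z; case: w. Qed.

Lemma creZ (a : R) z : cre (a%:C%C * z) = a * cre z.
Proof. by case: z => x y /=; rewrite mul0r subr0. Qed.

Lemma intrC (e : int) : (e%:~R : R[i]) = (e%:~R)%:C%C.
Proof. by rewrite rmorph_int. Qed.

Lemma conj_direction z : z != 0 -> exists w, cmod w = 1 /\ 0 < cre (w * z).
Proof.
rewrite -cmod_eq0 => z0; have zp : 0 < cmod z by rewrite lt_neqAle eq_sym z0 cmod_ge0.
exists (((cmod z)^-1)%:C%C * z^*%C); split.
  rewrite cmodM cmod_real ger0_norm ?invr_ge0 ?ltW //.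
  suff -> : cmod z^*%C = cmod z by rewrite mulVf.
  by case: (z) => a b /=; rewrite sqrrN.
suff -> : (((cmod z)^-1)%:C%C * z^*%C) * z = (cmod z)%:C%C by [].
have : z * z^*%C = ((cmod z)%:C%C) ^+ 2 by rewrite -cmodE sqr_normc.
rewrite -mulrA [z^*%C * z]mulrC => ->; rewrite expr2 mulrA -rmorphM mulVf // mul1r //.
Qed.

(** On the unit circle 1 = z z^*, whence z^2 + 1 = 2 z Re z: a small real part puts z^2 near -1. *)
Lemma sqr_unit_near z : cmod z = 1 -> cmod (z ^+ 2 + 1) = 2 * `|cre z|.
Proof.
move=> z1; have zz : z * z^*%C = 1 by rewrite -sqr_normc cmodE z1 expr1n.
have -> : z ^+ 2 + 1 = z * (2 * (cre z)%:C%C) by rewrite -addcJ -zz; ring.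
have -> : (2 : R[i]) = (2 : R)%:C%C by rewrite rmorph_nat.
by rewrite -rmorphM cmodM z1 mul1r cmod_real normrM ger0_norm.
Qed.

Lemma bounded_values (q : R) (z : R[i]) (S : seq R) :
  (forall f, ev q f = 0 -> ev z f = 0) ->
  exists B, forall f, ev q f \in S -> cmod (ev z f) <= B.
Proof.
move=> key; elim: S => [|s S [B hB]]; first by exists 0.
have [[f fs]|nf] := pselect (exists f, ev q f = s).
  exists (Num.max B (cmod (ev z f))) => g; rewrite inE => /orP[/eqP gs|/hB h].
    suff -> : ev z g = ev z f by rewrite le_max lexx orbT.
    by apply/eqP; rewrite -subr_eq0 -evB; apply/eqP/key; rewrite evB gs fs subrr.
  by rewrite le_max h.
exists B => g; rewrite inE => /orP[/eqP gs|/hB //]; by exfalso; apply: nf; exists g.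
Qed.

End Modulus.

(** * Digit sequences driven by the phase of a conjugate *)

Section Pattern.
Variables (R : realType) (q c : R) (z w : R[i]).
Hypotheses (q1 : 1 < q) (q2 : q <= 2) (cE : q * c = c + 1).

Definition phase i := cre (w * z ^- i).
Definition phase_bit i : int := if 0 < phase i then 1 else 0.

Fixpoint pattern (k : nat) : {poly int} :=
  if k is k'.+1 then pattern k' * 'X + (phase_bit k)%:P else 0.

Lemma pattern_bdig k : bdig k (pattern k).
Proof.
elim: k => [|k IH]; first exact: bdig0.
by apply: bdig_cons => //; rewrite /phase_bit; case: ifP.
Qed.

(** The digits after place k amount, after division by q^j, to a number in [0, c]; so a truncated
    pattern expands a point of [0, c] as [finite_differences] requires. *)
Lemma pattern_tail k j :
  0 <= ev q (pattern (k + j)) - q ^+ j * ev q (pattern k) <= c * (q ^+ j - 1).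
Proof.
elim: j => [|j IH]; first by rewrite addn0 expr0 mul1r !subrr mulr0 lexx.
rewrite addnS /= !evE exprS -/pattern.
have -> : ev q (pattern (k + j)) * q + (phase_bit (k + j).+1)%:~R - q * q ^+ j * ev q (pattern k)
  = q * (ev q (pattern (k + j)) - q ^+ j * ev q (pattern k)) + (phase_bit (k + j).+1)%:~R by ring.
have -> : c * (q * q ^+ j - 1) = q * (c * (q ^+ j - 1)) + 1.
  by move: (q ^+ j) => Q; have e := cE; lra.
have q0 : 0 < q := lt_trans ltr01 q1.
have /andP[b0 b1] : 0 <= ((phase_bit (k + j).+1)%:~R : R) <= 1 by rewrite /phase_bit; case: ifP; rewrite ?ler01 ?lexx.
case/andP: IH => h1 h2; apply/andP; split; first by rewrite addr_ge0 // mulr_ge0 // ltW.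
by rewrite lerD // ler_pM2l.
Qed.

Fixpoint greedy (y : R) (k : nat) : {poly int} :=
  if k is k'.+1 then
    greedy y k' * 'X + (if 1 <= q * (q ^+ k' * y - ev q (greedy y k')) then 1 else 0)%:P
  else 0.

Lemma greedy_bdig y k : bdig k (greedy y k).
Proof.
elim: k => [|k IH]; first exact: bdig0.
by apply: bdig_cons => //; case: ifP.
Qed.

Lemma greedy_tail y k : 0 <= y <= c -> 0 <= q ^+ k * y - ev q (greedy y k) <= c.
Proof.
move=> hy; have c1 := c_ge1 q1 q2 cE; have q0 : 0 < q := lt_trans ltr01 q1.
elim: k => [|k IH]; first by rewrite expr0 mul1r ev0 subr0.
rewrite /= !evE exprS; set r := q ^+ k * y - ev q (greedy y k) in IH *.
have -> d : q * q ^+ k * y - (ev q (greedy y k) * q + d) = q * r - d by rewrite /r; ring.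
move: (r) IH => {}r /andP[h0 h1].
have {}h0 : 0 <= q * r by rewrite mulr_ge0 // ltW.
have {}h1 : q * r <= q * c by rewrite ler_pM2l.
by have := cE; case: (leP 1 (q * r)) => hr; rewrite ?mulr1z ?mulr0z; lra.
Qed.

Variable h : {poly int}.

(** Closed form of the iteration h := X h + e, where e is a pattern digit minus a greedy digit of
    y. *)
Definition state y k := 'X^k * h + pattern k - greedy y k.

Definition digit_diff y k : int := if k is k'.+1 then
  phase_bit k - (if 1 <= q * (q ^+ k' * y - ev q (greedy y k')) then 1 else 0) else 0.

Lemma state_succ y k : state y k.+1 = state y k * 'X + (digit_diff y k.+1)%:P.
Proof. by rewrite /state /digit_diff /= polyCB exprS; ring. Qed.

Definition gain y k := cre (w * z ^- k * ev z (state y k)).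

(* The digit difference never opposes the sign of the phase, whatever the greedy
   digit, so the gain increases by an absolute value. *)
Lemma gain_succ y k : z != 0 -> gain y k.+1 = gain y k + `|(digit_diff y k.+1)%:~R * phase k.+1|.
Proof.
move=> z0; rewrite /gain state_succ !evE mulrDr creD; congr (cre _ + _).
  by rewrite exprS; field; rewrite z0 expf_neq0.
rewrite mulrC intrC creZ -/(phase k.+1); symmetry.
apply: ger0_norm; rewrite /digit_diff /phase_bit; case: ltP => hr; case: ifP => _; rewrite ?subrr ?subr0 ?mul0r ?mul1r //.
- by rewrite ltW.
- by rewrite sub0r mulrN1z mulN1r oppr_ge0.
Qed.

Lemma gain_le y k : cmod w = 1 -> gain y k <= (cmod z ^+ k)^-1 * cmod (ev z (state y k)).
Proof.
move=> w1; apply: (le_trans (cre_le_cmod _)).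
by rewrite !cmodM w1 mul1r Normc.normcV cmodX.
Qed.

End Pattern.

Lemma abszB1 (m : int) : (absz (m - 1) <= absz m + 1)%N.
Proof. lia. Qed.

(** * Exclusion of conjugates of modulus at least 1 *)

Section NoConjugate.
Variables (R : realType) (q c : R) (z : R[i]) (v : {poly int}).
Hypotheses (q1 : 1 < q) (q2 : q < 2) (cE : q * c = c + 1) (sepq : separated q).
Hypotheses (hv : sdig v) (v0 : 0 < ev q v) (v1 : (1 + q) * ev q v <= 1).
Hypotheses (key : forall f, ev q f = 0 -> ev z f = 0).
Hypotheses (yek : forall f, ev z f = 0 -> ev q f = 0).
Hypotheses (z1 : 1 <= cmod z) (zq : z != q%:C%C).

(** At z, (m + n X) v is (m + n q) v(z) + n (z - q) v(z). The direction w favours the second term, n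
    makes it dominate, and m = -floor(n q) keeps m + n q in [0, 1). Lowering m by 1 gives a shift of
    the other sign at q. *)
Lemma two_step_choice : exists (w : R[i]) (m n : int),
  [/\ cmod w = 1, 0 < cre (w * ev z (two_step v m n)),
      0 < cre (w * ev z (two_step v (m - 1) n)),
      0 <= ev q (two_step v m n) <= ev q v &
      - ev q v <= ev q (two_step v (m - 1) n) <= 0].
Proof.
have vz : ev z v != 0 by apply/eqP => /yek ev0; have := v0; rewrite ev0 ltxx.
have [|w [w1 wd]] := @conj_direction R ((z - q%:C%C) * ev z v).
  by rewrite mulf_neq0 // subr_eq0.
set d := (z - q%:C%C) * ev z v in wd; pose b := cre (w * ev z v).
pose n := (Num.truncn (`|b| / cre (w * d))).+1.
have nb : `|b| < n%:R * cre (w * d) by rewrite -ltr_pdivrMr // truncnS_gt.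
pose m := - Num.floor (n%:R * q).
have reE (k : int) : cre (w * ev z (two_step v k n%:Z)) =
    (k%:~R + n%:R * q) * b + n%:R * cre (w * d).
  have -> : w * ev z (two_step v k n%:Z) =
     (k%:~R + n%:R * q)%:C%C * (w * ev z v) + (n%:R)%:C%C * (w * d).
    rewrite /two_step /d !evE !intrC [in RHS]rmorphD [in RHS]rmorphM /= -pmulrn.
    ring.
  by rewrite creD !creZ.
have mn : 0 <= m%:~R + n%:R * q <= 1.
  have := floor_itv (n%:R * q); rewrite /m mulrNz intrD => /andP[h1 h2].
  by rewrite mulr1z in h2; lra.
have evq (k : int) : ev q (two_step v k n%:Z) = (k%:~R + n%:R * q) * ev q v.
  by rewrite /two_step !evE -pmulrn.
have pos (t : R) : `|t| <= 1 -> 0 < t * b + n%:R * cre (w * d).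
  move=> t1; have : - (t * b) <= `|b|.
    by rewrite (le_trans (ler_norm _)) // normrN normrM ler_piMl.
  by move: nb; lra.
exists w, m, n%:Z; split => //.
- by rewrite reE pos // ger0_norm; lra.
- by rewrite reE pos // intrB mulr1z ler_norml; lra.
- by rewrite evq; have v0' := v0; nra.
- by rewrite evq intrB mulr1z; have v0' := v0; nra.
Qed.

(** The data w, S, B, g0 are fixed before the number K of steps: the pattern is cut at place K,
    which changes the orbit but none of the bounds. *)
Lemma controlled_orbit : exists (w : R[i]) (S : seq R) (B g0 : R),
  [/\ cmod w = 1, 0 < g0, forall f, ev q f \in S -> cmod (ev z f) <= B &
  forall K, exists (u : nat -> {poly int}) (e : nat -> int) (g : nat -> R),
  [/\ g0 <= g 0%N, forall k, (k <= K)%N -> ev q (u k) \in S,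
     forall k, u k.+1 = u k * 'X + (e k.+1)%:P,
     forall k, g k.+1 = g k + `|(e k.+1)%:~R * cre (w * z ^- k.+1)| &
     forall k, g k <= (cmod z ^+ k)^-1 * cmod (ev z (u k))]].
Proof.
have q2' := ltW q2; have q0 : 0 < q := lt_trans ltr01 q1.
have [w [m [n [w1 re1 re2 ev1 ev2]]]] := two_step_choice.
pose N := (absz m + absz n + 1)%N.
have hN1 : (absz m + absz n <= N)%N by exact: leq_addr.
have hN2 : (absz (m - 1)%R + absz n <= N)%N by rewrite /N addnAC leq_add2r abszB1.
have [S hS] := finite_differences q1 q2' cE sepq hv v0 v1 N.
have [B hB] := bounded_values S key.
have c1 := c_ge1 q1 q2' cE.
have z0 : z != 0 by rewrite -cmod_eq0 gt_eqF // (lt_le_trans ltr01).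
pose g0 := Num.min (cre (w * ev z (two_step v m n))) (cre (w * ev z (two_step v (m - 1) n))).
have g00 : 0 < g0 by rewrite lt_min re1 re2.
exists w, S, B, g0; split => // K.
suff [h [y [hg hs]]] : exists h y, g0 <= gain q z w h y 0 /\
    forall k, (k <= K)%N -> ev q (state q z w h y k) \in S.
  exists (state q z w h y), (digit_diff q z w y), (gain q z w h y); split => //.
  - exact: state_succ.
  - by move=> k; exact: gain_succ.
  - by move=> k; exact: gain_le.
pose x := ev q (pattern z w K) / q ^+ K.
have xk k : (k <= K)%N -> 0 <= q ^+ k * x - ev q (pattern z w k) <= c.
  move=> kK; have := pattern_tail z w q1 cE k (K - k); rewrite subnKC //.
  have qK := qn_gt0 q1 (K - k).
  have -> : q ^+ k * x = ev q (pattern z w K) / q ^+ (K - k).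
    have eK : q ^+ K = q ^+ (K - k) * q ^+ k by rewrite -exprD subnK.
    by rewrite /x eK; field; rewrite !expf_neq0 ?gt_eqF.
  have -> : ev q (pattern z w K) - q ^+ (K - k) * ev q (pattern z w k) =
    q ^+ (K - k) * (ev q (pattern z w K) / q ^+ (K - k) - ev q (pattern z w k)).
    by field; rewrite expf_neq0 ?gt_eqF.
  move=> /andP[h1 h2]; apply/andP; split; first by rewrite pmulr_rge0 in h1.
  by rewrite -(ler_pM2l qK) (le_trans h2) // mulrC ler_pM2r; lra.
have hx : 0 <= x <= c by have := xk 0%N (leq0n _); rewrite expr0 mul1r ev0 subr0.
have v1' : ev q v <= 1 / 2 by have h1 := v1; have h2 := q1; have h3 := v0; nra.
have fin m' : (absz m' + absz n <= N)%N -> 0 <= x + ev q (two_step v m' n) <= c ->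
   forall k, (k <= K)%N -> ev q (state q z w (two_step v m' n) (x + ev q (two_step v m' n)) k) \in S.
  move=> mn hxh k kK; apply: (hS _ _ mn _ _ _ x) => //.
  - exact: pattern_bdig.
  - exact: greedy_bdig.
  - exact: xk.
  - exact: greedy_tail.
have g0E h y : gain q z w h y 0 = cre (w * ev z h).
  by rewrite /gain /state /= addr0 subr0 !expr0 mul1r invr1 mulr1.
(* The shift at q has size at most v(q) <= 1/2 <= c/2 and is directed inwards, so the shifted point
   stays in [0, c]. *)
have [xc|xc] := leP x (c / 2).
  exists (two_step v m n), (x + ev q (two_step v m n)).
  split; first by rewrite g0E ge_min lexx.
  by apply: fin => //; lra.
exists (two_step v (m - 1) n), (x + ev q (two_step v (m - 1) n)).
split; first by rewrite g0E ge_min lexx orbT.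
by apply: fin => //; lra.
Qed.

Lemma gain_mono (g : nat -> R) (d : nat -> R) : (forall k, g k.+1 = g k + `|d k|) ->
  forall a b, (a <= b)%N -> g a <= g b.
Proof.
move=> hg a b /subnKC <-; elim: (b - a)%N => [|j IH]; first by rewrite addn0.
by rewrite addnS hg (le_trans IH) // lerDl.
Qed.

(** The gain stays above g0, but is at most B / |z|^K. *)
Lemma no_conjugate_outside : cmod z <= 1.
Proof.
rewrite leNgt; apply/negP => zgt.
have [w [S [B [g0 [w1 g00 hB main]]]]] := controlled_orbit.
have [K hK] := expr_unbounded ((B + 1) / g0) zgt.
have [u [e [g [hg hs _ gS gle]]]] := main K.
have h1 := gain_mono gS (leq0n K); have h2 := gle K; have h3 := hB _ (hs K (leqnn K)).
have zK : 0 < cmod z ^+ K by rewrite exprn_gt0 // (lt_trans ltr01).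
have : g0 <= (cmod z ^+ K)^-1 * B.
  by apply: (le_trans hg); apply: (le_trans h1); apply: (le_trans h2); rewrite ler_pM2l ?invr_gt0.
rewrite mulrC ler_pdivlMr // => h4; move: hK; rewrite ler_pdivrMr // mulrC; lra.
Qed.

(** Among D consecutive digits one is nonzero, and two nonzero digits less than 2D places apart
    cannot both have a small phase. So each block of 2D places adds at least eps to the gain, which
    is bounded by B. *)
Lemma no_conjugate_unit : cmod z = 1 -> False.
Proof.
move=> zunit; have q0 : 0 < q := lt_trans ltr01 q1.
have z0 : z != 0 by rewrite -cmod_eq0 gt_eqF // zunit.
have [w [S [B [g0 [w1 g00 hB main]]]]] := controlled_orbit.
have [M hM] : exists M, {in S, forall s, `|s| <= M}.
  elim: (S) => [|s t [M hM]]; first by exists 0.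
  exists (Num.max M `|s|) => s'; rewrite inE => /orP[/eqP ->|/hM h]; rewrite le_max ?lexx ?orbT //.
  by rewrite h.
have [eta eta0 heta] : exists2 eta, 0 < eta & {in S, forall s, s != 0 -> eta <= `|s|}.
  elim: (S) => [|s t [e e0 he]]; first by exists 1.
  have [s0|s0] := eqVneq s 0.
    by exists e => // s'; rewrite inE => /orP[/eqP ->|/he //]; rewrite s0 eqxx.
  exists (Num.min e `|s|); first by rewrite lt_min e0 normr_gt0.
  move=> s'; rewrite inE => /orP[/eqP ->|/he h] s'0; rewrite ge_min ?lexx ?orbT //.
  by rewrite h.
have [D hD] := expr_unbounded ((M + 1) / eta) q1.
(* Two small phases would put the squares of w z^-i and w z^-(i+j) near -1, hence z^(2j) near 1; but
   z^(2j) = 1 would carry over to q. *)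
have [eps eps0 heps] : exists2 eps, 0 < eps & forall i j, (0 < j < D.*2)%N ->
    eps <= `|cre (w * z ^- i)| \/ eps <= `|cre (w * z ^- (i + j))|.
  have [e e0 he] : exists2 e, 0 < e & forall j, (0 < j < D.*2)%N -> e <= cmod (z ^+ (j.*2) - 1).
    elim: (D.*2) => [|d [e e0 he]]; first by exists 1 => // j; rewrite ltn0 andbF.
    have [d0|d0] := posnP d.
      by exists 1 => // -[|j] //; rewrite d0.
    exists (Num.min e (cmod (z ^+ d.*2 - 1))).
      rewrite lt_min e0 lt_neqAle cmod_ge0 andbT eq_sym cmod_eq0 subr_eq0.
      apply/eqP => zd; have := @yek ('X^(d.*2) - 1); rewrite !evE zd subrr => /(_ erefl) /eqP.
      by rewrite subr_eq0 gt_eqF // exprn_egt1 // double_eq0 -lt0n.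
    move=> j /andP[j0]; rewrite ltnS leq_eqVlt => /orP[/eqP ->|jd]; rewrite ge_min ?lexx ?orbT //.
    by rewrite he ?j0.
  exists (e / 4); first by rewrite divr_gt0.
  move=> i j hj; set r := cre _; set r' := cre _; have zi k : cmod (w * z ^- k) = 1.
    by rewrite cmodM w1 mul1r Normc.normcV cmodX zunit expr1n invr1.
  have h1 := sqr_unit_near (zi i); have h2 := sqr_unit_near (zi (i + j)%N).
  have : cmod (z ^+ j.*2 - 1) <= cmod ((w * z ^- (i + j)) ^+ 2 + 1) + cmod ((w * z ^- i) ^+ 2 + 1).
    have -> : z ^+ j.*2 - 1 = z ^+ j.*2 * ((w * z ^- (i + j)) ^+ 2 + 1) - ((w * z ^- i) ^+ 2 + 1).
      by rewrite -muln2 exprM exprD; field; rewrite !expf_neq0.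
    by rewrite (le_trans (ler_cmodD _ _)) // cmodN cmodM cmodX zunit expr1n mul1r.
  rewrite h1 h2 -/r -/r'; have := he _ hj.
  by have [|] := leP (e / 4) `|r|; [left|right; lra].
have [T hT] : exists T, B < T%:R * eps.
  by exists (Num.truncn (B / eps)).+1; rewrite -ltr_pdivrMr // truncnS_gt.
have [u [e [g [hg hs uS gS gle]]]] := main (T * D.*2)%N.
have mono := gain_mono gS.
have gpos k : 0 < g k by apply: (lt_le_trans g00); apply: (le_trans hg); exact: mono.
have unz k : ev q (u k) != 0.
  apply/eqP => /key uz; have := gle k; rewrite uz Normc.normc0 mulr0 leNgt gpos //.
(* D zero digits would multiply a value of size at least eta by q^D and bring it above M. *)
have move1 k : (k + D <= T * D.*2)%N ->
    exists i, (k <= i < k + D)%N /\ e i.+1 <> 0.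
  move=> kD; have [//|nex] := pselect (exists i, (k <= i < k + D)%N /\ e i.+1 <> 0).
  exfalso.
  have st j : (j <= D)%N -> u (k + j)%N = u k * 'X^j.
    elim: j => [|j IH] jD; first by rewrite addn0 expr0 mulr1.
    have {}IH := IH (ltnW jD).
    rewrite addnS uS exprSr mulrA -IH.
    have [->|ne] := eqVneq (e (k + j).+1) 0; first by rewrite polyC0 addr0.
    exfalso; apply: nex; exists (k + j)%N.
    by rewrite leq_addr ltn_add2l jD; split => //; exact/eqP.
  have e1 := hM _ (hs _ kD); have e2 := heta _ (hs k (leq_trans (leq_addr _ _) kD)) (unz k).
  move: e1; rewrite st // evM evXn normrM [`|q ^+ _|]ger0_norm; last by rewrite exprn_ge0 // ltW.
  move: hD; rewrite ler_pdivrMr // => h1 h2.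
  have : eta * q ^+ D <= `|ev q (u k)| * q ^+ D by rewrite ler_pM2r // exprn_gt0.
  by rewrite [eta * _]mulrC; lra.
have gain1 i : e i.+1 <> 0 -> g i + `|cre (w * z ^- i.+1)| <= g i.+1.
  move=> /eqP e0; rewrite gS lerD2l normrM ler_peMl // -intr_norm ler1z.
  by clear -e0; lia.
have block k : (k + D.*2 <= T * D.*2)%N -> g k + eps <= g (k + D.*2)%N.
  move=> kD; have [|i [hi ui]] := @move1 k; first by clear -kD; lia.
  have [|j [hj uj]] := @move1 (k + D)%N; first by clear -kD; lia.
  have hg1 := gain1 _ ui; have hg2 := gain1 _ uj.
  have m1 := mono k i; have m2 := mono i.+1 j; have m3 := mono j.+1 (k + D.*2)%N.
  have {m1} m1 : g k <= g i by apply: m1; clear -hi; lia.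
  have {m2} m2 : g i.+1 <= g j by apply: m2; clear -hi hj; lia.
  have {m3} m3 : g j.+1 <= g (k + D.*2)%N by apply: m3; clear -hj; lia.
  have := heps i.+1 (j - i)%N; rewrite addSn subnKC; last by clear -hi hj; lia.
  have n1 := normr_ge0 (cre (w * z ^- i.+1)); have n2 := normr_ge0 (cre (w * z ^- j.+1)).
  by case; [clear -hi hj; lia|lra|lra].
have grow t : (t <= T)%N -> t%:R * eps <= g (t * D.*2)%N.
  elim: t => [|t IH] tT; first by rewrite mul0r mul0n ltW.
  have := IH (ltnW tT); have := @block (t * D.*2)%N.
  by rewrite addnC -mulSn leq_mul2r tT orbT => /(_ isT); rewrite -natr1; lra.
have := grow T (leqnn T); have := gle (T * D.*2)%N.
have := hB _ (hs _ (leqnn (T * D.*2))); rewrite zunit expr1n invr1 mul1r => a1 a2 a3.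
by have := lt_le_trans hT (le_trans a3 (le_trans a2 a1)); rewrite ltxx.
Qed.

End NoConjugate.

(** * Multinacci numbers, where the orbit of 1 reaches 0 *)

Section Multinacci.
Variables (R : realType) (q : R) (z : R[i]) (k : nat).
Hypotheses (q1 : 1 < q) (q2 : q < 2).
Hypotheses (xk : ev q (one_orbit k.+1) = 0).
Hypotheses (xpos : forall j, (j <= k)%N -> 0 < ev q (one_orbit j)).
Hypotheses (zk : ev z (one_orbit k.+1) = 0) (zq : z != q%:C%C).

Let t := z^-1.
Let x j := ev q (one_orbit j).

(** Synthetic division of [one_orbit j.+1] by X - q, reversed: the orbit values x_j are the
    coefficients of the quotient, taken here at t = 1/z. *)
Fixpoint orbit_series (j : nat) : R[i] :=
  if j is j'.+1 then orbit_series j' + (x j)%:C%C * t ^+ j else 1.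

Let xS j : x j.+1 = q * x j - 1.
Proof. by rewrite /x ev_one_orbit mulrC. Qed.

Let x_le j : (j <= k)%N -> x j.+1 <= x j /\ x j <= 1.
Proof.
have h1 := q1; have h2 := q2.
elim: j => [|j IH] jk; first by rewrite xS /x /= ev1; lra.
have [a b] := IH (ltnW jk); have p := xpos jk; rewrite -/(x _) in p.
have b' : x j.+1 <= 1 by lra.
by split => //; rewrite xS; nra.
Qed.

Let orbit_seriesE j : z != 0 ->
  (ev z (one_orbit j.+1) - (x j.+1)%:C%C) * t ^+ j.+1 = (1 - q%:C%C * t) * orbit_series j.
Proof.
move=> z0; have zt : z * t = 1 by rewrite /t divff.
elim: j => [|j IH].
  rewrite ev_one_orbit xS /x /= !ev1 mulr1 rmorphB rmorph1 expr1 mul1r mulr1.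
  by rewrite -[X in _ = X - _]zt; ring.
have -> : orbit_series j.+1 = orbit_series j + (x j.+1)%:C%C * t ^+ j.+1 by [].
have -> : (x j.+2)%:C%C = q%:C%C * (x j.+1)%:C%C - 1 by rewrite xS rmorphB rmorphM rmorph1.
rewrite mulrDr -IH ev_one_orbit (exprS t j.+1).
move: (ev z _) (x j.+1)%:C%C (t ^+ j.+1) => E X T.
have -> : (E * z - 1 - (q%:C%C * X - 1)) * (t * T) = E * T * (z * t) - q%:C%C * X * (t * T) by ring.
by rewrite zt; ring.
Qed.

(* Eneström-Kakeya: a polynomial with positive decreasing coefficients has no
   zero in the closed unit disc. *)
Lemma multinacci_conjugate : cmod z < 1.
Proof.
have h1 := q1; have h2 := q2.
rewrite ltNge; apply/negP => z1.
have z0 : z != 0 by rewrite -cmod_eq0 gt_eqF // (lt_le_trans ltr01).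
have t1 : cmod t <= 1 by rewrite Normc.normcV invf_le1 // (lt_le_trans ltr01).
have tj j : cre (t ^+ j) <= 1.
  by rewrite (le_trans (cre_le_cmod _)) // cmodX exprn_ile1 // cmod_ge0.
have Pk : orbit_series k = 0.
  have := orbit_seriesE k z0; rewrite zk /x xk subrr mul0r => /esym/eqP.
  rewrite mulf_eq0 => /orP[|/eqP //]; rewrite subr_eq0 => /eqP e.
  by case/negP: zq; apply/eqP; rewrite -[LHS]mul1r e mulfVK.
have [k0|k0] := posnP k.
  by move/eqP: Pk; rewrite k0 /= oner_eq0.
(* Multiplication by 1 - t turns the coefficients into differences x_i - x_(i-1) <= 0, and Re t^i <=
   1 is used for i > 1. At j = k the vanishing of the series forces Re t >= 1, hence t = 1. *)
have main j : (0 < j <= k)%N ->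
  (2 - q) * (1 - cre t) + x j <= cre ((1 - t) * orbit_series j + (x j)%:C%C * t ^+ j.+1).
  elim: j => // -[|j] IH /andP[_ jk].
    have -> : (1 - t) * orbit_series 1 + (x 1%N)%:C%C * t ^+ 2 =
      1 + (x 1%N - 1)%:C%C * t by rewrite /= rmorphB rmorph1; ring.
    by rewrite creD creZ xS /x /= ev1 /=; lra.
  have {}IH := IH (ltnW jk).
  have -> : (1 - t) * orbit_series j.+2 + (x j.+2)%:C%C * t ^+ j.+3 =
    ((1 - t) * orbit_series j.+1 + (x j.+1)%:C%C * t ^+ j.+2) + (x j.+2 - x j.+1)%:C%C * t ^+ j.+2.
    by rewrite [orbit_series j.+2]/= -/(orbit_series j.+1) rmorphB /= !exprS; ring.
  rewrite creD creZ; have := tj j.+2; have [] := x_le (ltnW jk); nra.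
have := main k; rewrite k0 leqnn Pk mulr0 add0r creZ => /(_ isT) hk.
have xk0 := xpos (leqnn k); rewrite -/(x k) in xk0.
have re1 : 1 <= cre t.
  have := tj k.+1; rewrite leNgt; move: hk; move: (cre (t ^+ _)) => r; nra.
have tE : t = 1.
  have : cmod t ^+ 2 <= 1 by rewrite exprn_ile1 // cmod_ge0.
  move: re1; rewrite /cmod; case: (t) => a b /= a1.
  rewrite sqr_sqrtr ?addr_ge0 ?sqr_ge0 // => ab.
  have b0 : b ^+ 2 = 0 by apply/eqP; rewrite eq_le sqr_ge0 andbT; nra.
  have a1' : a = 1 by nra.
  by move/eqP: b0; rewrite expf_eq0 /= => /eqP ->; rewrite a1'.
have pos j : (j <= k)%N -> 1 <= cre (orbit_series j).
  elim: j => [|j IH] jk //=; rewrite tE expr1n mulr1 creD (le_trans (IH (ltnW jk))) // lerDl.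
  by rewrite ltW // xpos.
by have := pos k (leqnn k); rewrite Pk /= ler10.
Qed.

End Multinacci.

Theorem separated_pisot (R : realType) (q : R) : 1 < q -> q < 2 -> separated q ->
  exists Q : {poly int}, [/\ Q \is monic, irreducible_poly (map_poly intr Q : {poly rat}),
    ev q Q = 0 & forall z : R[i], ev z Q = 0 -> z != q%:C%C -> `|z| < 1].
Proof.
move=> q1 q2 sepq; pose c := (q - 1)^-1.
have cE : q * c = c + 1 by rewrite /c; field; rewrite subr_eq0 gt_eqF.
have [P mP qP] := separated_algebraic q1 (ltW q2) cE sepq.
have [Q [mQ irrQ qQ]] := monic_irreducible_factor mP qP.
exists Q; split => // z zQ zq; rewrite cmodE ltcR.
have key f : ev q f = 0 -> ev z f = 0 by exact: conjugate_root irrQ qQ zQ.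
have yek f : ev z f = 0 -> ev q f = 0 by exact: conjugate_root irrQ zQ qQ.
have [[v [hv v0 v1]]|[k [xk xpos]]] := small_spectrum_element q1 q2 cE; last first.
  exact: multinacci_conjugate q1 q2 xk xpos (key _ xk) zq.
rewrite ltNge; apply/negP => z1.
apply: (no_conjugate_unit q1 q2 cE sepq hv v0 v1 key yek z1 zq).
apply/eqP; rewrite eq_le z1 andbT.
exact: (no_conjugate_outside q1 q2 cE sepq hv v0 v1 key yek z1 zq).
Qed.

(** * Density of orbits in a base with a non-separated power *)

Lemma not_separated_small (R : realType) (q d : R) : ~ separated q -> 0 < d ->
  exists f, sdig f /\ 0 < ev q f < d.
Proof.
move=> nsep d0.
have [[f [hf fd]]|none] := pselect (exists f, sdig f /\ 0 < `|ev q f| < d).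
  have [f0|f0] := leP 0 (ev q f); first by exists f; rewrite -{1 2}(ger0_norm f0).
  by exists (- f); split; [exact: sdigN|rewrite evN -(ltr0_norm f0)].
exfalso; apply: nsep; exists d => // f hf.
have [->|f0] := eqVneq (ev q f) 0; [by left|right].
rewrite leNgt; apply/negP => fd; apply: none; exists f.
by rewrite normr_gt0 f0 fd.
Qed.

Lemma scale_into (R : realType) (q y e : R) (D : nat) : 1 < q -> 0 < y -> y * q ^+ D <= e ->
  exists L, (D <= L)%N /\ e / q < y * q ^+ L <= e.
Proof.
move=> q1 y0 yD; have q0 : 0 < q := lt_trans ltr01 q1.
have ex : exists n, e < y * q ^+ n.
  have [n hn] := expr_unbounded ((e + 1) / y) q1; exists n.
  by move: hn; rewrite ler_pdivrMr // mulrC; lra.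
case: (ex_minnP ex) => n hn nmin.
have Dn : (D < n)%N.
  rewrite ltnNge; apply/negP => nD; have : y * q ^+ n <= y * q ^+ D.
    by rewrite ler_pM2l // ler_weXn2l // ltW.
  by move: hn yD; lra.
case: n Dn hn nmin => // n; rewrite ltnS => Dn hn nmin; exists n; split => //.
rewrite ltr_pdivrMr // -mulrA -exprSr hn /= leNgt; apply/negP => /nmin.
by rewrite ltnn.
Qed.

Section Chain.
Variables (R : realType) (q e : R).
Hypotheses (q1 : 1 < q) (nsep : ~ separated q) (e0 : 0 < e).

(* Replacing the negative part of a small element of the spectrum by its positive
   part increases a 0/1 sum by at most e; successive replacements use
   disjoint sets of positions. *)
Lemma fine_chain (C : R) : exists D a0, forall T, 0 <= T <= C ->
  exists E, bdig D E /\ T - e <= ev q E - a0 <= T.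
Proof.
have q0 : 0 < q := lt_trans ltr01 q1.
(* A scaled replacement moves the sum by more than e/q and at most e, so each one extends the range
   of T by e/q. *)
suff main (j : nat) : exists D a0, forall T, 0 <= T <= e + j%:R * (e / q) ->
    exists E, bdig D E /\ T - e <= ev q E - a0 <= T.
  have eq0 : 0 < e / q by rewrite divr_gt0.
  have [D [a0 h]] := main (Num.truncn (`|C| / (e / q))).+1; exists D, a0 => T hT; apply: h.
  have := truncnS_gt (`|C| / (e / q)); rewrite ltr_pdivrMr //.
  have := ler_norm C; have := e0; lra.
elim: j => [|j [D [a0 IH]]].
  exists 0%N, 0 => T; rewrite mul0r addr0 => hT; exists 0; rewrite ev0 subr0.
  by split; [exact: bdig0|lra].
have qD : 0 < q ^+ D by rewrite exprn_gt0.
have [f [/sdig_split[l [p [r [bp br ->]]]]]] := not_separated_small nsep (divr_gt0 e0 qD).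
rewrite evB ltr_pdivlMr // => /andP[f0 /ltW fD].
have [L [DL /andP[L1 L2]]] := scale_into q1 f0 fD.
have widen E : bdig D E -> bdig L E by exact: bdig_widen.
exists (l + L)%N, (a0 + q ^+ L * ev q r) => T hT.
have [TC|TC] := leP T (e + j%:R * (e / q)).
  have [|E [bE hE]] := IH T; first by case/andP: hT => -> _.
  exists (r * 'X^L + E); split; first by apply: bdig_cat => //; exact: widen.
  by rewrite !evE; lra.
have je : 0 <= j%:R * (e / q) by rewrite mulr_ge0 // ltW // divr_gt0.
have [|E [bE hE]] := IH (T - (ev q p - ev q r) * q ^+ L).
  by move: hT; rewrite -natr1 mulrDl mul1r; lra.
exists (p * 'X^L + E); split; first by apply: bdig_cat => //; exact: widen.
by rewrite !evE; lra.
Qed.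

End Chain.

(** E occupies the places divisible by m and h those just above; m > 1 prevents collisions. *)
Lemma coef_interleave (h E : {poly int}) (m i : nat) : (1 < m)%N ->
  ((h \Po 'X^m) * 'X + (E \Po 'X^m))`_i =
    if (m %| i)%N then E`_(i %/ m) else if (m %| i.-1)%N then h`_(i.-1 %/ m) else 0.
Proof.
move=> m1; have m0 : (0 < m)%N := ltnW m1.
rewrite coefD coefMX !coef_comp_poly_Xn //.
case: i => [|i] /=; first by rewrite dvdn0 add0r.
case: ifP => d1; case: ifP => d2; rewrite ?add0r ?addr0 //.
by have := dvdn_addr 1 d1; rewrite addn1 d2 dvdn1 => /esym/eqP m_1; rewrite m_1 in m1.
Qed.

Lemma bdig_interleave (h E : {poly int}) (m D : nat) : (1 < m)%N -> bdig D h -> bdig D E ->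
  bdig (D * m) ((h \Po 'X^m) * 'X + (E \Po 'X^m)).
Proof.
move=> m1 [sh hh] [sE hE]; have m0 : (0 < m)%N := ltnW m1.
split; last by move=> i; rewrite coef_interleave //; case: ifP => // _; case: ifP.
apply/leq_sizeP => i Di; rewrite coef_interleave //.
case: ifP => [_|d1]; first by rewrite nth_default // (leq_trans sE) // leq_divRL.
case: ifP => // d2; rewrite nth_default // (leq_trans sh) // leq_divRL //.
move: Di; rewrite leq_eqVlt => /orP[/eqP Di|]; last by case: (i).
by move: d1; rewrite -Di dvdn_mull.
Qed.

(** With the hull normalized to [0, 1], b^k x - (b - 1) f(b) is the preimage of x under the word of
    f. There are three layers in f: leading digits a in base b leave a remainder at most q^D, h at
    the places 1 mod m leaves at most b, and E at the places 0 mod m, from [fine_chain], reduces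
    this to e c / 2. *)
Lemma dense_orbit (R : realType) (b : R) (m : nat) (x s e : R) :
  1 < b -> (1 < m)%N -> b ^+ m < 2 -> ~ separated (b ^+ m) -> 0 < x < 1 -> 0 < e ->
  exists k f, bdig k f /\ s < b ^+ k * x - (b - 1) * ev b f < s + e.
Proof.
move=> b1 m1; set q := b ^+ m => q2 nsep hx e0.
have b0 : 0 < b := lt_trans ltr01 b1.
have q1 : 1 < q by rewrite exprn_egt1 // -lt0n ltnW.
have q0 : 0 < q := lt_trans ltr01 q1.
have bq : b <= q by rewrite -[X in X <= _]expr1 ler_weXn2l ?ltW // ltnW.
have b2 : b <= 2 by lra.
pose c := (b - 1)^-1; have c0 : 0 < c by rewrite invr_gt0 subr_gt0.
have bc : (b - 1) * c = 1 by rewrite mulfV // subr_eq0 gt_eqF.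
have cE : b * c = c + 1 by move: bc; lra.
pose d := (q - 1)^-1; have dE : q * d = d + 1.
  by rewrite /d; field; rewrite subr_eq0 gt_eqF.
have d1 := c_ge1 q1 (ltW q2) dE.
have ec0 : 0 < e * c / 2 by rewrite !mulr_gt0 // invr_gt0.
have [D [a0 fine]] := fine_chain q1 nsep ec0 b.
have qD1 := qn_ge1 q1 D; have qD0 := qn_gt0 q1 D.
have coarse j T : 0 <= T <= q ^+ D * ((b ^+ j - 1) * c + 1) ->
    exists a h, [/\ bdig j a, bdig D h & 0 <= T - (q ^+ D * ev b a + b * ev q h) <= b].
  move=> hT; have [|a [ba ha]] := cover1 b1 b2 cE (k := j) (y := T / q ^+ D).
    case/andP: hT => hT1 hT2.
    by rewrite divr_ge0 ?(ltW qD0) //= ler_pdivrMr // mulrC.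
  have hT' : 0 <= T - q ^+ D * ev b a <= q ^+ D.
    have -> : T - q ^+ D * ev b a = q ^+ D * (T / q ^+ D - ev b a) by field; rewrite gt_eqF.
    by case/andP: ha => h1 h2; rewrite mulr_ge0 ?(ltW qD0) //= ler_piMr // ltW.
  have [|h [bh hh]] := cover1 q1 (ltW q2) dE (k := D) (y := (T - q ^+ D * ev b a) / b).
    have h1 : (T - q ^+ D * ev b a) / b <= q ^+ D.
      by rewrite ler_pdivrMr // (le_trans (andP hT').2) // ler_peMr // ltW.
    rewrite divr_ge0 ?(ltW b0) //=; last by case/andP: hT'.
    rewrite (le_trans h1) // -lerBlDr ler_peMr //; lra.
  exists a, h; split => //.
  have -> : T - (q ^+ D * ev b a + b * ev q h) =
     b * ((T - q ^+ D * ev b a) / b - ev q h) by field; rewrite gt_eqF.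
  by case/andP: hh => h1 h2; rewrite mulr_ge0 ?(ltW b0) //= ler_piMr // ltW.
(* Adding e c / 4 moves the final error from [0, e c / 2] into the open interval (0, e c); a0
   compensates the offset of [fine_chain]. *)
pose K := s * c + e * c / 4 + a0.
have x0 : 0 < x by case/andP: hx.
have x1 : 0 < 1 - x by case/andP: hx; lra.
have [j hj] := expr_unbounded (`|K| / (c * x) + (c + `|K|) / (c * (1 - x))) b1.
have cx : 0 < c * x by rewrite mulr_gt0.
have cx1 : 0 < c * (1 - x) by rewrite mulr_gt0.
have hj1 : `|K| <= b ^+ j * (c * x).
  rewrite -ler_pdivrMr //; apply: le_trans hj; rewrite lerDl divr_ge0 ?(ltW cx1) //.
  by rewrite addr_ge0 // ltW.
have hj2 : c + `|K| <= b ^+ j * (c * (1 - x)).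
  by rewrite -ler_pdivrMr //; apply: le_trans hj; rewrite lerDr divr_ge0 // ltW.
pose T := q ^+ D * b ^+ j * x * c - K.
have [|a [h [ba bh hah]]] := @coarse j T.
  have nK := ler_norm K; have nK' := ler_norm (- K); rewrite normrN in nK'.
  have K0 := normr_ge0 K.
  move: hj1 hj2; rewrite /T; move: (q ^+ D) (b ^+ j) qD1 => Q B Q1 hB1 hB2.
  have p1 : 0 <= (Q - 1) * (B * (c * x)) by rewrite mulr_ge0 //; lra.
  have p2 : 0 <= (Q - 1) * (B * (c * (1 - x)) - c) by rewrite mulr_ge0 //; lra.
  by apply/andP; split; lra.
have [|E [bE hE]] := fine (T - (q ^+ D * ev b a + b * ev q h)) => //.
pose f := a * 'X^(D * m) + ((h \Po 'X^m) * 'X + (E \Po 'X^m)).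
exists (j + D * m)%N, f; split.
  by apply: bdig_cat => //; exact: bdig_interleave.
have evf : ev b f = q ^+ D * ev b a + b * ev q h + ev q E.
  by rewrite /f !evE !ev_comp -/q mulnC exprM -/q; ring.
have evF : b ^+ (j + D * m) * x - (b - 1) * ev b f - s = (b - 1) * (T + K - ev b f - s * c).
  rewrite /T exprD mulnC exprM -/q.
  transitivity (((b - 1) * c) * (q ^+ D * b ^+ j * x - s) - (b - 1) * ev b f); last by ring.
  by rewrite bc; ring.
have r1 : 0 < T + K - ev b f - s * c < e * c by rewrite evf /K; lra.
have b10 : 0 < b - 1 by rewrite subr_gt0.
have eE : e = (b - 1) * (e * c) by rewrite mulrCA bc mulr1.
case/andP: r1 => r1 r2; apply/andP; split.
  by rewrite -subr_gt0 evF mulr_gt0.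
by rewrite -ltrBlDl evF [X in _ < X]eE ltr_pM2l.
Qed.

(** * There is no Pisot number below 144/125 *)

Section Blaschke.
Variable R : realType.
Local Notation C := (R[i]).
Implicit Types (r : C) (u y : nat -> C) (s : seq C).

(* Taylor coefficients of u(X) (X - r) / (1 - r^* X), and below of u(X) / (1 - r^* X). *)
Fixpoint blaschke r u (n : nat) : C :=
  if n is n'.+1 then r^*%C * blaschke r u n' + u n' - r * u n else - r * u 0%N.

Fixpoint blaschke_aux r u (n : nat) : C :=
  if n is n'.+1 then r^*%C * blaschke_aux r u n' + u n else u 0%N.

Definition energy u N : R := \sum_(n < N.+1) cmod (u n) ^+ 2.

Lemma energy0 u : energy u 0 = cmod (u 0%N) ^+ 2.
Proof. by rewrite /energy big_ord1. Qed.

Lemma energy_recr u N : energy u N.+1 = energy u N + cmod (u N.+1) ^+ 2.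
Proof. by rewrite /energy big_ord_recr. Qed.

Lemma cmod_sqr (a b : R) : cmod (a +i* b)%C ^+ 2 = a ^+ 2 + b ^+ 2.
Proof. by rewrite /= sqr_sqrtr // addr_ge0 ?sqr_ge0. Qed.

Lemma blaschkeE r u n : blaschke r u n.+1 = blaschke_aux r u n - r * blaschke_aux r u n.+1.
Proof.
have bS k : blaschke r u k.+1 = r^*%C * blaschke r u k + u k - r * u k.+1 by [].
have aS k : blaschke_aux r u k.+1 = r^*%C * blaschke_aux r u k + u k.+1 by [].
elim: n => [|n IH]; first by rewrite /=; ring.
by rewrite bS IH !aS; ring.
Qed.

(** A Blaschke factor preserves the l^2 norm; partial sums leave a boundary term. One step is |A -
    r^* B|^2 = |B - r A|^2 + (1 - |r|^2)(|A|^2 - |B|^2), with B, A consecutive values of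
    [blaschke_aux]. *)
Lemma blaschke_energy r u N :
  energy u N = energy (blaschke r u) N + (1 - cmod r ^+ 2) * cmod (blaschke_aux r u N) ^+ 2.
Proof.
elim: N => [|N IH].
  by rewrite !energy0 [blaschke _ _ _]/= [blaschke_aux _ _ _]/= mulNr cmodN cmodM; ring.
rewrite !energy_recr IH blaschkeE.
have -> : u N.+1 = blaschke_aux r u N.+1 - r^*%C * blaschke_aux r u N by rewrite /=; ring.
move: (blaschke_aux r u N) (blaschke_aux r u N.+1) (energy _ N) => [a b] [a' b'] E.
case: r IH => x y _; simpc; rewrite !cmod_sqr; ring.
Qed.

Lemma blaschke_energy_le r u N : cmod r <= 1 -> energy (blaschke r u) N <= energy u N.
Proof.
move=> r1; rewrite (blaschke_energy r u) lerDl mulr_ge0 ?sqr_ge0 //.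
by rewrite subr_ge0 exprn_ile1 // cmod_ge0.
Qed.

Definition blaschke_seq s u := foldl (fun u r => blaschke r u) u s.

Lemma blaschke_seq_energy_le s u N : {in s, forall r, cmod r <= 1} ->
  energy (blaschke_seq s u) N <= energy u N.
Proof.
elim: s u => [|r s IH] u hs //=.
apply: le_trans (blaschke_energy_le _ _ (hs r (mem_head _ _))).
by apply: IH => t ts; apply: hs; rewrite inE ts orbT.
Qed.

Variable N : nat.
Definition eqm (f g : {poly C}) := forall n, (n <= N)%N -> f`_n = g`_n.
Definition trunc u : {poly C} := \poly_(i < N.+1) u i.

Lemma eqm_mull p f g : eqm f g -> eqm (p * f) (p * g).
Proof.
move=> fg n nN; rewrite !coefM; apply: eq_bigr => i _; rewrite fg //.
by rewrite (leq_trans (leq_subr _ _)).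
Qed.

Definition numer s : {poly C} := \prod_(r <- s) ('X - r%:P).
Definition denom s : {poly C} := \prod_(r <- s) (1 - (r^*%C)%:P * 'X).

Lemma numer_cons r s : numer (r :: s) = ('X - r%:P) * numer s.
Proof. by rewrite /numer big_cons. Qed.

Lemma coef_denom_factor (a : C) (F : {poly C}) n :
  ((1 - a%:P * 'X) * F)`_n = F`_n - a * (if n is n'.+1 then F`_n' else 0).
Proof. by rewrite mulrBl mul1r coefB -mulrA coefCM coefXM; case: n. Qed.

Lemma coef_numer_factor (a : C) (F : {poly C}) n :
  (('X - a%:P) * F)`_n = (if n is n'.+1 then F`_n' else 0) - a * F`_n.
Proof. by rewrite mulrBl coefB coefCM coefXM; case: n. Qed.

Lemma blaschke_trunc r u :
  eqm ((1 - (r^*%C)%:P * 'X) * trunc (blaschke r u)) (('X - r%:P) * trunc u).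
Proof.
move=> n nN; rewrite coef_denom_factor coef_numer_factor !coef_poly !ltnS nN.
case: n nN => [|n] nN; first by rewrite /=; ring.
by rewrite coef_poly ltnS ltnW // coef_poly ltnS ltnW //=; ring.
Qed.

Lemma blaschke_seq_trunc s u :
  eqm (denom s * trunc (blaschke_seq s u)) (numer s * trunc u).
Proof.
elim: s u => [|r s IH] u; first by rewrite /denom /numer !big_nil !mul1r.
rewrite /denom /numer !big_cons -/(denom s) -/(numer s) /= => n nN.
rewrite -mulrA (eqm_mull _ (IH _)) // mulrCA [('X - _) * _]mulrC -mulrA.
exact: eqm_mull (blaschke_trunc r u) _ nN.
Qed.

Lemma size_numer s : size (numer s) = (size s).+1.
Proof. exact: size_prod_XsubC. Qed.

Lemma size_denom s : (size (denom s) <= (size s).+1)%N.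
Proof.
elim: s => [|r s IH]; first by rewrite /denom big_nil size_poly1.
rewrite /denom big_cons -/(denom s) (leq_trans (size_polyMleq _ _)) //=.
have : (size (1 - (r^*%C)%:P * 'X : {poly C})%R <= 2)%N.
  rewrite (leq_trans (size_polyD _ _)) // geq_max size_polyN size_poly1 /=.
  by rewrite (leq_trans (size_polyMleq _ _)) // size_polyX addn2 /= size_polyC; case: eqP.
by move: IH; move: (size (_ - _ : {poly C})%R) (size (denom s)) (size s) => a b d; clear; lia.
Qed.

(** Reversal with conjugation, factor by factor: when [numer s] has integer coefficients, [denom s]
    is its reciprocal P^*. *)
Lemma coef_denom s i j : (i + j = size s)%N -> (denom s)`_i = ((numer s)`_j)^*%C.
Proof.
elim: s i j => [|r s IH] i j /=.
  move/eqP; rewrite addn_eq0 => /andP[/eqP -> /eqP ->].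
  by rewrite /denom /numer !big_nil !coefC /= oppr0.
rewrite /denom /numer !big_cons -/(denom s) -/(numer s).
rewrite coef_denom_factor coef_numer_factor rmorphB rmorphM /=.
case: i => [|i]; case: j => [|j] //=.
- rewrite add0n => -[js]; rewrite (IH 0%N j) // mulr0 subr0.
  by rewrite [(numer s)`_j.+1]nth_default ?conjc0 ?mulr0 ?subr0 // size_numer js.
- rewrite addn0 => -[is_]; rewrite (IH i 0%N) ?addn0 //; congr (_ - _).
  by rewrite oppr0 nth_default // (leq_trans (size_denom _)) // is_.
rewrite addSn addnS => -[ijs]; rewrite (IH i.+1 j) ?(IH i j.+1) ?addSn ?addnS //.
Qed.

End Blaschke.

Lemma intr_between (R : realType) (b lo hi : int) :
  (lo%:~R : R) < b%:~R -> (b%:~R : R) < hi%:~R -> lo < b < hi.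
Proof. by rewrite !ltr_int => -> ->. Qed.

(* The walk starts at 1 and cannot stay forever at 1, 2 or 3, since x is not an
   integer; passing from 1 to 2, from 2 to 3 and then leaving 3 costs more than
   x^2 when x <= 144/125. *)
Lemma no_cheap_integer_walk (R : realType) (x : R) (a : nat -> int) :
  1 < x <= 144 / 125 -> 0 < a 0%N ->
  (forall N, ((a 0%N)%:~R : R) ^+ 2 + \sum_(i < N.+1) ((a i.+1)%:~R - x * (a i)%:~R) ^+ 2
     < 1 + x ^+ 2) -> False.
Proof.
move=> hx a0.
have e0 : (0 : int)%:~R = 0 :> R by [].
have e1 : (1 : int)%:~R = 1 :> R by [].
have e2 : (2 : int)%:~R = 2 :> R by [].
have e3 : (3 : int)%:~R = 3 :> R by [].
have e4 : (4 : int)%:~R = 4 :> R by [].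
pose cost N := ((a 0%N)%:~R : R) ^+ 2 + \sum_(i < N) ((a i.+1)%:~R - x * (a i)%:~R) ^+ 2.
move=> hc; have costS n : cost n.+1 = cost n + ((a n.+1)%:~R - x * (a n)%:~R) ^+ 2.
  by rewrite /cost big_ord_recr /= addrA.
have {}hc n : cost n < 1 + x ^+ 2.
  by apply: le_lt_trans (hc n); rewrite -/(cost n.+1) costS lerDl sqr_ge0.
have a1 : a 0%N = 1.
  have := hc 0%N; rewrite /cost big_ord0 addr0 => h.
  have : 0 < a 0%N < 2; last by clear; lia.
  apply: (@intr_between R); first by rewrite ltr_int.
  by rewrite e2; have : (0 : R) < (a 0%N)%:~R; [rewrite ltr0z | nra].
have x2 : x ^+ 2 <= 144 / 125 * x by nra.
(* The first part records the cost of climbing to each height; the second holds because every step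
   costs at least (x - 1)^2, and it bounds the length of the walk. *)
have inv n : [\/ a n = 1, a n = 2 /\ 1 + (2 - x) ^+ 2 <= cost n |
     a n = 3 /\ 1 + (2 - x) ^+ 2 + (3 - 2 * x) ^+ 2 <= cost n] /\
     1 + n%:R * (x - 1) ^+ 2 <= cost n.
  elim: n => [|n [IH1 IH2]].
    by split; [constructor 1|rewrite /cost big_ord0 a1 mul0r !addr0 expr1n].
  have nS : n.+1%:R * (x - 1) ^+ 2 = n%:R * (x - 1) ^+ 2 + (x - 1) ^+ 2 :> R.
    by rewrite -natr1 mulrDl mul1r.
  have := hc n.+1; rewrite costS nS.
  set B : R := (a n.+1)%:~R.
  have x1 : 0 <= (x - 1) ^+ 2 by exact: sqr_ge0.
  have n0 : 0 <= n%:R * (x - 1) ^+ 2 by rewrite mulr_ge0.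
  move: IH2; move: (n%:R * (x - 1) ^+ 2) n0 => S S0 IH2.
  case: IH1 => [an|[an IH1]|[an IH1]]; rewrite an.
  - rewrite mulr1 => hB.
    have : 0 < a n.+1 < 3.
      apply: (@intr_between R); rewrite -/B; first by rewrite e0; nra.
      by rewrite e3; nra.
    move=> hb; have [e|e] : a n.+1 = 1 \/ a n.+1 = 2 by clear -hb; lia.
      by split; [constructor 1|move: hB; rewrite /B e e1; nra].
    by split; [constructor 2; split => //|]; move: hB; rewrite /B e e2; nra.
  - rewrite e2 => hB.
    have : 1 < a n.+1 < 4.
      apply: (@intr_between R); rewrite -/B; first by rewrite e1; nra.
      by rewrite e4; nra.
    move=> hb; have [e|e] : a n.+1 = 2 \/ a n.+1 = 3 by clear -hb; lia.
      by split; [constructor 2; split => //|]; move: hB; rewrite /B e e2; nra.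
    by split; [constructor 3; split => //|]; move: hB; rewrite /B e e3; nra.
  rewrite e3 => hB.
  have : 2 < a n.+1 < 4.
    apply: (@intr_between R); rewrite -/B; first by rewrite e2; nra.
    by rewrite e4; nra.
  move=> hb; have e : a n.+1 = 3 by clear -hb; lia.
  by split; [constructor 3; split => //|]; move: hB; rewrite /B e e3; nra.
have x1 : 0 < (x - 1) ^+ 2 by rewrite exprn_gt0 //; lra.
pose n := (Num.truncn (x ^+ 2 / (x - 1) ^+ 2)).+1.
have : x ^+ 2 < n%:R * (x - 1) ^+ 2 by rewrite -ltr_pdivrMr // truncnS_gt.
by have := hc n; have [_] := inv n; lra.
Qed.

Lemma ev_rmorph (K L : comNzRingType) (phi : {rmorphism K -> L}) (x : K) f :
  ev (phi x) f = phi (ev x f).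
Proof.
rewrite /ev -horner_map -map_poly_comp; congr (_.[_]); apply: eq_map_poly => k /=.
by rewrite rmorph_int.
Qed.

Lemma irreducible_separable (K : numFieldType) (Q : {poly int}) :
  irreducible_poly (map_poly intr Q : {poly rat}) ->
  separable_poly (map_poly intr Q : {poly K}).
Proof.
move=> irr; pose p : {poly rat} := map_poly intr Q.
have -> : map_poly intr Q = map_poly (ratr : rat -> K) p.
  by rewrite -map_poly_comp; apply: eq_map_poly => k /=; rewrite ratr_int.
rewrite separable_map separable_poly.unlock irreducible_poly_coprime //.
apply/negP => /dvdp_leq; have [p1 _] := irr; rewrite -/p in p1.
have p2 : (0 < (size p).-1)%N by rewrite -ltnS prednK // ltnW.
have sd : size (deriv p) = (size p).-1.
  have := @size_poly_eq rat (size p).-1 (fun i => p`_i.+1 *+ i.+1); rewrite /deriv; apply.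
  by rewrite prednK // mulrn_eq0 negb_or -lt0n p2 // -lead_coefE lead_coef_eq0 -size_poly_gt0 ltnW.
by rewrite -size_poly_gt0 sd p2 -ltnS prednK ?ltnn ?(ltnW p1) // => /(_ isT).
Qed.

(** Taylor coefficients of Y(X) / (1 - x X), where Y has the coefficients y. *)
Fixpoint geometric (C : nzRingType) (x : C) (y : nat -> C) (n : nat) : C :=
  if n is n'.+1 then y n + x * geometric x y n' else y 0%N.

(** * Siegel's argument *)

Section SmallPisot.
Variables (R : realType) (x : R) (Q : {poly int}).
Hypotheses (hx : 1 < x <= 144 / 125) (mQ : Q \is monic).
Hypotheses (irrQ : irreducible_poly (map_poly intr Q : {poly rat})) (xQ : ev x Q = 0).
Hypotheses (conjQ : forall z : R[i], ev z Q = 0 -> z != x%:C%C -> cmod z < 1).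

Local Notation C := (R[i]).
Let P : {poly C} := map_poly intr Q.

Let x1 : 1 < x. Proof. by case/andP: hx. Qed.

Let P_coef i : P`_i = (Q`_i)%:~R.
Proof. by rewrite coef_map. Qed.

Let xCQ : ev x%:C%C Q = 0.
Proof. by rewrite ev_rmorph xQ rmorph0. Qed.

Let root_neq0 (z : C) : ev z Q = 0 -> z != 0.
Proof.
move=> zQ; apply/eqP => z0.
have : ev x 'X = 0 by apply: (conjugate_root irrQ zQ xQ); rewrite evX.
by rewrite evX => x0; have := x1; rewrite x0 ltr10.
Qed.

Let Q0 : Q`_0 != 0.
Proof.
apply/eqP => q0; have /root_neq0/eqP : ev (0 : C) Q = 0; last by [].
by rewrite /ev horner_coef0 -/P P_coef q0.
Qed.

Let real_int (k : int) (a : R) : a%:C%C = k%:~R :> C -> a = k%:~R.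
Proof. by rewrite intrC => /complexI. Qed.

Let factorization : exists s : seq C, P = numer (x%:C%C :: s) /\ uniq (x%:C%C :: s).
Proof.
have [rs] := closed_field_poly_normal P.
rewrite (eqP (monic_map _ mQ)) scale1r => Prs.
have urs : uniq rs by rewrite -separable_prod_XsubC -Prs; exact: irreducible_separable.
have xrs : x%:C%C \in rs by rewrite -root_prod_XsubC -Prs; apply/eqP; exact: xCQ.
exists (rem x%:C%C rs); rewrite -(perm_uniq (perm_to_rem xrs)) urs; split => //.
by rewrite Prs /numer; apply: perm_big; exact: perm_to_rem.
Qed.

(** The root r makes Siegel's inequality strict. If all other roots were 1/x, separability would
    leave degree 1 or 2, and x or x + 1/x would be an integer, in (1, 2) or in (2, 3). *)
Let factorization_strict : exists (r : C) (s : seq C),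
  [/\ P = numer [:: x%:C%C, r & s], {in r :: s, forall z, cmod z < 1}, r != 0 & r^*%C * x%:C%C != 1].
Proof.
have [s [Ps us]] := factorization.
have rt z : z \in s -> ev z Q = 0.
  by move=> zs; apply/eqP; rewrite -[_ == _]/(root P z) Ps root_prod_XsubC inE zs orbT.
have lt1 z : z \in s -> cmod z < 1.
  move=> zs; apply: conjQ; first exact: rt.
  by apply/eqP => zx; move: us; rewrite /= -zx zs.
have [r rs rx] : exists2 r, r \in s & r^*%C * x%:C%C != 1.
  have [//|nex] := pselect (exists2 r, r \in s & r^*%C * x%:C%C != 1); exfalso.
  have all r : r \in s -> r = (x^-1)%:C%C.
    move=> rs; apply/eqP/negPn/negP => ne; apply: nex; exists r => //.
    apply/eqP => rx1; case/negP: ne; apply/eqP; rewrite -[r]conjcK.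
    have xC0 : x%:C%C != 0 :> C by exact: root_neq0.
    by rewrite -[r^*%C](mulfK xC0) rx1 mul1r -fmorphV conjc_real.
  have xb := hx; have xi : x * x^-1 = 1 by rewrite divff // gt_eqF // (lt_trans ltr01).
  case: s Ps us all {rt lt1 nex} => [|r [|r' s]] Ps us all.
  - have := P_coef 0; rewrite Ps /numer big_seq1 coefB coefX coefC /= sub0r -rmorphN.
    move=> /real_int e.
    have : 1 < - Q`_0 < 2.
      apply: (@intr_between R); rewrite mulrNz -e opprK; first by [].
      by rewrite -[2%:~R]/(2 : R); lra.
    by clear; lia.
  - have := P_coef 1; rewrite Ps /numer big_cons big_seq1 (all r (mem_head _ _)).
    have -> : ('X - (x%:C%C)%:P) * ('X - ((x^-1)%:C%C)%:P) =
       'X^2 - (x%:C%C + (x^-1)%:C%C)%:P * 'X + (x%:C%C * (x^-1)%:C%C)%:P :> {poly C}.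
      by rewrite polyCD polyCM expr2; ring.
    rewrite !coefD coefN coefXn coefMX !coefC /= add0r addr0 -rmorphD -rmorphN => /real_int e.
    have : 2 < - Q`_1 < 3; last by clear; lia.
    apply: (@intr_between R); rewrite mulrNz -e opprK.
      by rewrite -[2%:~R]/(2 : R); nra.
    by rewrite -[3%:~R]/(3 : R); nra.
  have er : r = (x^-1)%:C%C by apply: all; rewrite inE eqxx.
  have er' : r' = (x^-1)%:C%C by apply: all; rewrite !inE eqxx orbT.
  by move: us; rewrite er er' /= !inE eqxx /= andbF.
exists r, (rem r s); split => //.
- rewrite Ps /numer; apply: perm_big; rewrite perm_cons; exact: perm_to_rem.
- by move=> z; rewrite -(perm_mem (perm_to_rem rs)); exact: lt1.
- exact/root_neq0/rt.
Qed.

Lemma no_small_pisot : False.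
Proof.
have [r [s [Ps lt1 r0 rx]]] := factorization_strict.
have r1 := lt1 r (mem_head _ _).
(* h is X - x, y its product with the Blaschke factors of the other roots, and A = y / (1 - x X) is
   the series P/P^*. *)
pose h n : C := if n is n'.+1 then (if n' is 0%N then 1 else 0) else - x%:C%C.
pose y := blaschke_seq (r :: s) h.
pose A := geometric x%:C%C y.
have energy_lt N : energy y N.+1 < 1 + x ^+ 2.
  have le1 : {in s, forall z, cmod z <= 1} by move=> z zs; rewrite ltW // lt1 // inE zs orbT.
  apply: (le_lt_trans (blaschke_seq_energy_le (blaschke r h) N.+1 le1)).
  have eh n : energy h n.+1 = 1 + x ^+ 2.
    elim: n => [|n IH]; last by rewrite energy_recr IH /h Normc.normc0 expr0n addr0.
    by rewrite energy_recr energy0 /h cmodN cmod_real Normc.normc1 real_normK ?num_real // expr1n addrC.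
  rewrite -(eh N) (blaschke_energy r h) ltrDl mulr_gt0 //.
    by rewrite subr_gt0 exprn_ilt1 // cmod_ge0.
  rewrite exprn_gt0 // lt_neqAle cmod_ge0 andbT eq_sym cmod_eq0.
  suff -> : blaschke_aux r h N.+1 = r^*%C ^+ N * (1 - r^*%C * x%:C%C).
    by rewrite mulf_neq0 ?expf_neq0 ?conjc_eq0 // subr_eq0 eq_sym.
  have aS k : blaschke_aux r h k.+1 = r^*%C * blaschke_aux r h k + h k.+1 by [].
  elim: (N) => [|n IH]; first by rewrite aS /= expr0 mul1r; ring.
  by rewrite aS IH /h addr0 exprS mulrA.
have trunc_h N : eqm N.+1 (trunc N.+1 h) ('X - (x%:C%C)%:P).
  move=> n nN; rewrite coef_poly ltnS nN coefB coefX coefC /h.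
  case: n nN => [|[|n]] nN /=; [by rewrite sub0r|by rewrite subr0|by rewrite subr0].
have series N : eqm N.+1 (denom [:: x%:C%C, r & s] * trunc N.+1 A) P.
  move=> n nN; rewrite /denom big_cons -/(denom (r :: s)) -mulrA mulrCA.
  have step : eqm N.+1 ((1 - ((x%:C)^*%C)%:P * 'X) * trunc N.+1 A)%C (trunc N.+1 y).
    move=> k kN; rewrite coef_denom_factor conjc_real !coef_poly !ltnS kN.
    case: k kN => [|k] kN /=; first by rewrite mulr0 subr0.
    by rewrite coef_poly ltnS ltnW //= addrK.
  rewrite (eqm_mull _ step) //; have -> := blaschke_seq_trunc (r :: s) h nN.
  have -> : P = numer (r :: s) * ('X - (x%:C%C)%:P) by rewrite Ps (numer_cons x%:C%C) mulrC.
  exact: eqm_mull (trunc_h N) _ nN.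
pose int_valued (w : C) := exists k : int, w = k%:~R.
pose D := denom [:: x%:C%C, r & s].
have sP : size (numer [:: x%:C%C, r & s]) = (size s).+3 by rewrite size_numer.
have intD i : int_valued D`_i.
  have [is_|is_] := leqP i (size s).+2.
    have := @coef_denom R [:: x%:C%C, r & s] i ((size s).+2 - i) (subnKC is_).
    by rewrite -Ps P_coef => e; exists Q`_((size s).+2 - i); rewrite /D e intrC conjc_real.
  by exists 0; rewrite nth_default // (leq_trans (size_denom _)).
(* The constant term 1 makes division by P^* possible over the integers. *)
have D0 : D`_0 = 1.
  rewrite (@coef_denom R _ 0 (size s).+2) // -[(size s).+2]/(size s).+3.-1 -sP -lead_coefE.
  by rewrite (eqP (monic_prod_XsubC _ _ _)) conjc1.
have coefA n : A n + \sum_(i < n) D`_i.+1 * A (n - i.+1)%N = (Q`_n)%:~R.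
  have := series n n (leqnSn n); rewrite coefM big_ord_recl P_coef -/D D0 mul1r.
  rewrite subn0 coef_poly leqnSn => <-; congr (_ + _); apply: eq_bigr => i _.
  by rewrite coef_poly ltnS (leq_trans (leq_subr _ _)).
have intA n : int_valued (A n).
  elim/ltn_ind: n => n IH.
  have [k hk] : int_valued (\sum_(i < n) D`_i.+1 * A (n - i.+1)%N).
    apply: big_ind => [|_ _ [k ->] [l ->]|i _]; first by exists 0.
      by exists (k + l); rewrite intrD.
    have [k ->] := intD i.+1; have [|l ->] := IH (n - i.+1)%N.
      by rewrite ltn_subrL /= (leq_ltn_trans _ (ltn_ord i)).
    by exists (k * l); rewrite intrM.
  by exists (Q`_n - k); rewrite intrB -hk -coefA addrK.
have [a aE] := choice intA.
have a0 : a 0%N != 0.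
  have := coefA 0%N; rewrite big_ord0 addr0 aE => /intr_inj ->; exact: Q0.
have cost N : ((a 0%N)%:~R : R) ^+ 2 + \sum_(i < N.+1) ((a i.+1)%:~R - x * (a i)%:~R) ^+ 2
    < 1 + x ^+ 2.
  have sq (b : R) : cmod b%:C%C ^+ 2 = b ^+ 2 by rewrite cmod_real real_normK ?num_real.
  have y0 : y 0%N = ((a 0%N)%:~R : R)%:C%C by rewrite -intrC -aE.
  have yS i : y i.+1 = ((a i.+1)%:~R - x * (a i)%:~R)%:C%C.
    have rcB (b d : R) : (b - x * d)%:C%C = b%:C%C - x%:C%C * d%:C%C by rewrite rmorphB rmorphM.
    by rewrite rcB -!intrC -!aE [A i.+1]/(y i.+1 + _) addrK.
  apply: le_lt_trans (energy_lt N).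
  have -> : energy y N.+1 = cmod (y 0%N) ^+ 2 + \sum_(i < N.+1) cmod (y i.+1) ^+ 2.
    by rewrite /energy big_ord_recl; congr (_ + _); apply: eq_bigr => i _; rewrite lift0.
  by rewrite y0 sq lerD2l; apply: ler_sum => i _; rewrite yS sq.
have [a0p|a0n] := ltP 0 (a 0%N); first exact: no_cheap_integer_walk hx a0p cost.
apply: (@no_cheap_integer_walk R x (fun n => - a n)) => //.
  by rewrite oppr_gt0 lt_neqAle a0 a0n.
move=> N; rewrite mulrNz sqrrN; apply: le_lt_trans (cost N); rewrite lerD2l; apply: ler_sum => i _.
by rewrite !mulrNz mulrN opprK addrC -sqrrN opprB.
Qed.

End SmallPisot.

(* If b^2 and b^3 are both Pisot numbers, then so is b: a conjugate z of modulus at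
   least 1 has z^2 = b^2 and z^3 = b^3. *)
Lemma not_separated_small_base (R : realType) (b : R) : 1 < b -> b ^+ 2 < 53 / 40 ->
  ~ separated (b ^+ 2) \/ ~ separated (b ^+ 3).
Proof.
move=> b1 b2.
have [s2|] := pselect (separated (b ^+ 2)); [right => s3 | by left].
have bx : 1 < b <= 144 / 125 by nra.
have b3 : b ^+ 3 < 2 by rewrite exprS; nra.
have b21 : 1 < b ^+ 2 by rewrite exprn_egt1.
have b31 : 1 < b ^+ 3 by rewrite exprn_egt1.
have b22 : b ^+ 2 < 2 by lra.
have [Q2 [mQ2 _ bQ2 cQ2]] := separated_pisot b21 b22 s2.
have [Q3 [_ _ bQ3 cQ3]] := separated_pisot b31 b3 s3.
have mP : Q2 \Po 'X^2 \is monic.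
  by rewrite monicE lead_coef_comp ?size_polyXn // lead_coefXn expr1n mulr1 -monicE.
have bP : ev b (Q2 \Po 'X^2) = 0 by rewrite ev_comp.
have [Q [mQ irrQ bQ]] := monic_irreducible_factor mP bP.
apply: (@no_small_pisot R b Q bx mQ irrQ bQ) => z zQ zb.
have z2 : ev (z ^+ 2) Q2 = 0 by rewrite -ev_comp; exact: conjugate_root irrQ bQ zQ bP.
have z3 : ev (z ^+ 3) Q3 = 0.
  by rewrite -ev_comp; apply: conjugate_root irrQ bQ zQ _; rewrite ev_comp.
have root_lt1 m : cmod (z ^+ m) < 1 -> cmod z < 1.
  by rewrite cmodX !ltNge; apply: contra => z1; exact: exprn_ege1.
have [e2|n2] := eqVneq (z ^+ 2) (b ^+ 2)%:C%C; last first.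
  by apply: (root_lt1 2%N); have := cQ2 _ z2 n2; rewrite cmodE ltcR.
have [e3|n3] := eqVneq (z ^+ 3) (b ^+ 3)%:C%C; last first.
  by apply: (root_lt1 3%N); have := cQ3 _ z3 n3; rewrite cmodE ltcR.
have b0 : (b ^+ 2)%:C%C != 0 :> R[i].
  by rewrite -cmod_eq0 cmod_real normr_eq0 expf_eq0 /= gt_eqF // (lt_trans ltr01).
case/negP: zb; apply/eqP/(mulIf b0).
by rewrite -[in LHS]e2 -exprS e3 exprS rmorphM.
Qed.

(** * Universal codings *)

Section IFS.
Variables (R : realType) (n : nat) (lam : R) (p : 'I_n.+1 -> R) (lo hi : 'I_n.+1).
Hypotheses (lam0 : 1 / 2 < lam) (lam1 : lam < 1).
Hypotheses (p_lo : forall i, p lo <= p i) (p_hi : forall i, p i <= p hi) (lohi : p lo < p hi).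

Let lamp : 0 < lam. Proof. by apply: lt_trans lam0; rewrite divr_gt0. Qed.

Definition word_map (w : seq 'I_n.+1) (y : R) := foldr (ifs_map lam p) y w.

Lemma word_map_cat u w y : word_map (u ++ w) y = word_map u (word_map w y).
Proof. exact: foldr_cat. Qed.

Lemma word_mapB w y z : word_map w y - word_map w z = lam ^+ size w * (y - z).
Proof.
elim: w => [|i w IH] /=; first by rewrite expr0 mul1r.
by rewrite exprS -mulrA -IH /ifs_map; ring.
Qed.

Lemma word_map_le w y z : y <= z -> word_map w y <= word_map w z.
Proof.
by move=> yz; rewrite -subr_ge0 word_mapB mulr_ge0 ?subr_ge0 // exprn_ge0 // ltW.
Qed.

Lemma ifs_map_itv i y : p lo <= y <= p hi -> p lo <= ifs_map lam p i y <= p hi.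
Proof.
move=> hy; have := p_lo i; have := p_hi i; have := lamp; have := lam1.
by rewrite /ifs_map => h1 h2 h3 h4; apply/andP; split; nra.
Qed.

Lemma word_map_itv w y : p lo <= y <= p hi -> p lo <= word_map w y <= p hi.
Proof. by elim: w => //= i w IH /IH; exact: ifs_map_itv. Qed.

Lemma ifs_partialE a j : ifs_partial lam p a j = word_map (map a (iota 0 j)) 0.
Proof. by rewrite /ifs_partial /word_map foldr_map. Qed.

Lemma lamn_small (eps B : R) : 0 < eps -> exists N, forall j, (N <= j)%N -> lam ^+ j * B <= eps.
Proof.
move=> eps0; have il : 1 < lam^-1 by rewrite invf_gt1.
have [N hN] := expr_unbounded (`|B| / eps) il; exists N => j Nj.
have lN : 0 < lam ^+ N by rewrite exprn_gt0.
have : lam ^+ j * `|B| <= eps.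
  apply: (@le_trans _ _ (lam ^+ N * `|B|)).
    by apply: ler_wpM2r => //; rewrite ler_wiXn2l // ltW.
  by move: hN; rewrite exprVn ler_pdivrMr // mulrC ler_pdivlMr // mulrC.
apply: le_trans; rewrite ler_pM2l ?exprn_gt0 //; exact: ler_norm.
Qed.

Section Attractor.
Variable X : set R.
Hypothesis hX : is_attractor lam p X.

Let X_map x i : X x -> X (ifs_map lam p i x).
Proof. by move=> Xx; have [_ [_ ->]] := hX; exists i => //; exists x. Qed.

Let X_inv x : X x -> exists i y, X y /\ x = ifs_map lam p i y.
Proof. by have [_ [_ {1}->]] := hX; move=> [i _ [y Xy <-]]; exists i, y. Qed.

Let X_bounded : exists M, forall x, X x -> `|x| <= M.
Proof.
have [_ [cX _]] := hX; have [M [_ hM]] := compact_bounded cX.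
by exists (M + 1) => x Xx; apply: (hM (M + 1)) => //; rewrite ltrDl.
Qed.

Let limit_le (x a B : R) : (forall k, x <= a + lam ^+ k * B) -> x <= a.
Proof.
move=> h; rewrite leNgt; apply/negP => ax.
have e0 : 0 < (x - a) / 2 by rewrite divr_gt0 ?subr_gt0.
have [N hN] := lamn_small B e0.
by have := hN N (leqnn N); have := h N; lra.
Qed.

Let X_hull x : X x -> p lo <= x <= p hi.
Proof.
have [M hM] := X_bounded => Xx; pose B := `|M| + `|p lo| + `|p hi|.
have hB y : X y -> y - p hi <= B /\ p lo - y <= B.
  move=> Xy; have := hM y Xy; rewrite ler_norml /B.
  have := ler_norm M; have := ler_norm (p lo); have := ler_norm (- p hi).
  have := normr_ge0 (p lo); have := normr_ge0 (p hi).
  by rewrite normrN; lra.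
have step k : forall y, X y -> y - p hi <= lam ^+ k * B /\ p lo - y <= lam ^+ k * B.
  elim: k => [|k IH] y Xy; first by rewrite expr0 mul1r; exact: hB.
  have [i [z [Xz ->]]] := X_inv Xy; have [h1 h2] := IH z Xz.
  have h3 := p_lo i; have h4 := p_hi i; have l0 := lamp; have l1 := lam1.
  by rewrite exprS -mulrA /ifs_map; move: (lam ^+ k * B) h1 h2 => E h1 h2; split; nra.
apply/andP; split.
  by apply: (@limit_le _ _ B) => k; have [_] := step k x Xx; lra.
by apply: (@limit_le _ _ B) => k; have [] := step k x Xx; lra.
Qed.

(** As lam > 1/2, the images of the hull under the two extreme maps cover it; iterating, every point
    of the hull is a limit of points of X, which is closed. *)
Lemma attractorE : X = `[p lo, p hi].
Proof.
apply/seteqP; split => x /=; rewrite in_itv /=; first exact: X_hull.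
have [[x0 Xx0] [cX _]] := hX; move=> hx.
have closed_X : closed X by apply: compact_closed cX; exact: Rhausdorff.
have near k : forall y, p lo <= y <= p hi -> exists z, X z /\ `|y - z| <= lam ^+ k * (p hi - p lo).
  elim: k => [|k IH] y hy.
    exists x0; split => //; rewrite expr0 mul1r; have := X_hull Xx0.
    by rewrite ler_norml; lra.
  have l0 := lamp; have l1 := lam1; have l2 := lam0; have lh := lohi.
  pose i := if y <= lam * p hi + (1 - lam) * p lo then lo else hi.
  pose y' := (y - (1 - lam) * p i) / lam.
  have yE : y = ifs_map lam p i y' by rewrite /ifs_map /y'; field; rewrite gt_eqF.
  have hy' : p lo <= y' <= p hi.
    have pr : 0 <= (2 * lam - 1) * (p hi - p lo) by rewrite mulr_ge0 //; lra.
    by rewrite /y' ler_pdivlMr // ler_pdivrMr // /i; case: (leP y) => h; apply/andP; split; lra.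
  have [z [Xz hz]] := IH y' hy'; exists (ifs_map lam p i z); split; first exact: X_map.
  rewrite [X in `|X - _|]yE /ifs_map (_ : _ - _ = lam * (y' - z)); last by ring.
  by rewrite normrM gtr0_norm // exprS -mulrA ler_pM2l.
apply: closed_X => B /nbhs_ballP[e /= e0 eB].
have e2 : 0 < e / 2 by rewrite divr_gt0.
have [N hN] := lamn_small (p hi - p lo) e2.
have [z [Xz hz]] := near N x hx; exists z; split => //; apply: eB.
by rewrite /ball /=; have := hN N (leqnn N); lra.
Qed.

Lemma interior_attractor : interior X = [set x | p lo < x < p hi].
Proof.
by rewrite attractorE interior_itv_bnd; apply/seteqP; split => x /=; rewrite in_itv.
Qed.

End Attractor.
End IFS.

(** * Codings of the points of the open hull *)

Section Coding.
Variables (R : realType) (n : nat) (lam : R) (p : 'I_n.+1 -> R) (lo hi : 'I_n.+1).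
Hypotheses (lam0 : 1 / 2 < lam) (lam1 : lam < 1).
Hypotheses (p_lo : forall i, p lo <= p i) (p_hi : forall i, p i <= p hi) (lohi : p lo < p hi).

Let lamp : 0 < lam. Proof. by apply: lt_trans lam0; rewrite divr_gt0. Qed.

Local Notation wmap := (word_map lam p).

Lemma word_map_itv_oo w y : p lo < y < p hi -> p lo < wmap w y < p hi.
Proof.
elim: w => //= i w IH /IH; move: (word_map _ _ _ _) => z hz.
have := p_lo i; have := p_hi i; have := lamp; have := lam1.
by rewrite /ifs_map => h1 h2 h3 h4; apply/andP; split; nra.
Qed.

Section Universal.
Variable a : nat -> 'I_n.+1.
Hypothesis ua : universal a.

Let prefix j := map a (iota 0 j).
(** Started at [p lo] rather than at 0, the approximations are nondecreasing, which gives the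
    convergence of the coding. *)
Let v j := wmap (prefix j) (p lo).

Let prefixS j : prefix j.+1 = prefix j ++ [:: a j].
Proof. by rewrite /prefix -[j.+1]addn1 iotaD map_cat. Qed.

Let v_bound j : p lo <= v j <= p hi.
Proof. by apply: (word_map_itv lam0 lam1 p_lo p_hi); rewrite lexx ltW. Qed.

Let v_mono : {homo v : j k / (j <= k)%N >-> j <= k}.
Proof.
apply/nondecreasing_seqP => j; rewrite /v prefixS word_map_cat.
apply: (word_map_le p lam0) => /=.
by have /andP[] := @ifs_map_itv _ _ _ _ _ _ lam0 lam1 p_lo p_hi (a j) (p lo) (ltac:(by rewrite lexx ltW)).
Qed.

Let v_cvg : v @ \oo --> limn v.
Proof.
apply: nondecreasing_is_cvgn v_mono _; exists (p hi) => _ [j _ <-].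
by case/andP: (v_bound j).
Qed.

Let partial_cvg : ifs_partial lam p a @ \oo --> limn v.
Proof.
have -> : ifs_partial lam p a = (fun j => v j - lam ^+ j * p lo).
  apply/funext => j; rewrite ifs_partialE -/(prefix j).
  have := word_mapB lam p (prefix j) 0 (p lo); rewrite -/(v j) size_map size_iota => e.
  by rewrite -[LHS](subrK (v j)) e; ring.
rewrite -[limn v]subr0 -[X in _ - X](mul0r (p lo)).
apply: cvgB; first exact: v_cvg.
apply: cvgM; last exact: cvg_cst.
by apply: cvg_expr; rewrite gtr0_norm.
Qed.

Let occurs i : exists k, a k = i.
Proof. by have [k hk] := ua [:: i]; exists (k + 0)%N; rewrite hk. Qed.

Let v_split k j : (k < j)%N -> exists z, p lo <= z <= p hi /\
  v j = wmap (prefix k) (ifs_map lam p (a k) z).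
Proof.
move=> kj; exists (wmap (map a (iota k.+1 (j - k.+1))) (p lo)); split.
  by apply: (word_map_itv lam0 lam1 p_lo p_hi); rewrite lexx ltW.
have -> : v j = wmap (map a (iota 0 k ++ k :: iota k.+1 (j - k.+1))) (p lo).
  by rewrite /v /prefix -[in LHS](subnKC kj) addSnnS iotaD.
by rewrite map_cat word_map_cat.
Qed.

(** An occurrence of [hi] at place k keeps the limit at least lam^k (1 - lam)(p hi - p lo) above
    [p lo]; an occurrence of [lo] does the same below [p hi]. *)
Lemma universal_coding_interior : p lo < coding_map lam p a < p hi.
Proof.
rewrite /coding_map (cvg_lim (@Rhausdorff R) partial_cvg).
have cv : cvgn v by apply/cvg_ex; exists (limn v); exact: v_cvg.
have d0 k : 0 < lam ^+ k * ((1 - lam) * (p hi - p lo)).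
  by rewrite !mulr_gt0 ?exprn_gt0 ?subr_gt0.
apply/andP; split.
- have [k ak] := occurs hi.
  apply: (@lt_le_trans _ _ (p lo + lam ^+ k * ((1 - lam) * (p hi - p lo)))).
    by rewrite ltrDl.
  apply: limr_ge cv _; exists k.+1 => // j /= kj; have [z [hz ->]] := v_split kj.
  have := word_mapB lam p (prefix k) (ifs_map lam p (a k) z) (p lo).
  rewrite -/(v k) size_map size_iota ak => e; rewrite -[X in _ <= X](subrK (v k)) e addrC.
  apply: lerD; last by case/andP: (v_bound k).
  rewrite ler_pM2l ?exprn_gt0 // /ifs_map; have := lamp; move: hz; nra.
- have [k ak] := occurs lo.
  apply: (@le_lt_trans _ _ (p hi - lam ^+ k * ((1 - lam) * (p hi - p lo)))); last first.
    by rewrite ltrBlDr ltrDl.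
  apply: limr_le cv _; exists k.+1 => // j /= kj; have [z [hz ->]] := v_split kj.
  have := word_mapB lam p (prefix k) (ifs_map lam p (a k) z) (p hi).
  rewrite size_map size_iota ak => e.
  have /andP[_ h] : p lo <= wmap (prefix k) (p hi) <= p hi.
    by apply: (word_map_itv lam0 lam1 p_lo p_hi); rewrite lexx ltW.
  rewrite -[X in X <= _](subrK (wmap (prefix k) (p hi))) e addrC.
  apply: lerD => //; rewrite -mulrN ler_pM2l ?exprn_gt0 // /ifs_map; have := lamp; move: hz; nra.
Qed.

End Universal.

Section Construction.
Hypothesis dense : forall x, p lo < x < p hi -> forall w,
  exists u x', p lo < x' < p hi /\ x = wmap (u ++ w) x'.

Lemma universal_coding_exists x : p lo < x < p hi ->
  exists a, universal a /\ coding_map lam p a = x.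
Proof.
move=> hx.
have step (yw : R * seq 'I_n.+1) : exists uy : seq 'I_n.+1 * R,
    p lo < yw.1 < p hi -> p lo < uy.2 < p hi /\ yw.1 = wmap (uy.1 ++ yw.2) uy.2.
  case: yw => y w /=; have [hy|hy] := pselect (p lo < y < p hi).
    by have [u [x' [h1 h2]]] := dense hy w; exists (u, x').
  by exists ([::], 0) => /hy.
have [F hF] := choice step.
(* the k-th word, extended by one letter so that the code grows at each step *)
have [w wE] : exists w : nat -> seq 'I_n.+1, forall k, w k = odflt [::] (unpickle k) ++ [:: lo].
  by eexists.
have [st [st0 stS]] : exists st : nat -> seq 'I_n.+1 * R, st 0%N = ([::], x) /\
    forall k, st k.+1 = ((st k).1 ++ ((F ((st k).2, w k)).1 ++ w k), (F ((st k).2, w k)).2).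
  exists (fix st k := if k is k'.+1 then let s := st k' in
    let f := F (s.2, w k') in (s.1 ++ (f.1 ++ w k'), f.2) else ([::], x)).
  by [].
have st_inv k : p lo < (st k).2 < p hi /\ x = wmap (st k).1 (st k).2.
  elim: k => [|k [IH1 IH2]]; first by rewrite st0.
  have [h1 h2] := hF ((st k).2, w k) IH1.
  by rewrite stS /=; split => //; rewrite word_map_cat -h2.
have st_size k : (k <= size (st k).1)%N.
  elim: k => // k IH; rewrite stS /= !size_cat wE size_cat /= addn1 !addnS ltnS.
  by rewrite (leq_trans IH) // leq_addr.
(* Stage i + 1 has fixed more than i letters, and later stages only append. *)
pose a i := nth lo (st i.+1).1 i.
have st_nth k l i : (k <= l)%N -> (i < size (st k).1)%N -> nth lo (st l).1 i = nth lo (st k).1 i.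
  move=> /subnKC <- ik; elim: (l - k)%N => [|j IH]; first by rewrite addn0.
  have sk m : (size (st k).1 <= size (st (k + m)).1)%N.
    elim: m => [|m IHm]; first by rewrite addn0.
    by rewrite addnS stS /= size_cat (leq_trans IHm) // leq_addr.
  by rewrite addnS stS /= nth_cat (leq_trans ik (sk j)).
have a_nth k i : (i < size (st k).1)%N -> a i = nth lo (st k).1 i.
  move=> ik; have [ki|ki] := leqP k i.+1; first exact: st_nth.
  by rewrite /a -(@st_nth i.+1 k) // ltnW.
exists a; split.
  move=> v; pose k := pickle v.
  exists (size (st k).1 + size (F ((st k).2, w k)).1)%N => m mv.
  have wk : w k = v ++ [:: lo] by rewrite wE /k pickleK.
  rewrite (@a_nth k.+1); last first.
    by rewrite stS [fst _]/= !size_cat wk size_cat addnA ltn_add2l (leq_trans mv) // leq_addr.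
  rewrite stS /= nth_cat -addnA ltnNge leq_addr /= addKn.
  rewrite nth_cat ltnNge leq_addr /= addKn wk nth_cat mv.
  by apply: set_nth_default.
have pre j : map a (iota 0 j) = take j (st j).1.
  apply: (@eq_from_nth _ lo); first by rewrite size_map size_iota size_takel.
  move=> i; rewrite size_map size_iota => ij.
  rewrite (nth_map 0%N) ?size_iota // nth_iota // add0n nth_take // (@a_nth j) //.
  exact: leq_trans ij (st_size j).
apply: cvg_lim; first exact: Rhausdorff.
(* The first j maps send a point of the hull to x, and 0 to the partial value; the two differ by at
   most lam^j B. *)
apply/cvgrPdist_le => eps eps0; pose B := `|p lo| + `|p hi|.
have [N hN] := lamn_small lam0 lam1 B eps0; exists N => // j /= Nj.
rewrite ifs_partialE pre; have [hst ->] := st_inv j.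
rewrite -{1}(cat_take_drop j (st j).1) word_map_cat word_mapB subr0.
rewrite size_takel // normrM ger0_norm ?exprn_ge0 ?(ltW lamp) //.
apply: le_trans (hN j Nj); rewrite ler_pM2l ?exprn_gt0 //.
have := @word_map_itv_oo (drop j (st j).1) _ hst; move: (word_map _ _ _ _) => z hz.
rewrite ler_norml /B; have := ler_norm (p hi); have := ler_norm (- p lo); rewrite normrN.
by have := normr_ge0 (p lo); have := normr_ge0 (p hi); lra.
Qed.

End Construction.

Let b := lam^-1.

(** Digit 1 stands for [hi], digit 0 for [lo], and the coefficient at place k - 1 gives the first
    letter, that is, the outermost map. *)
Lemma word_of_bdig k f : bdig k f -> exists u, size u = k /\ forall y,
  wmap u y = p lo + lam ^+ k * (y - p lo + (p hi - p lo) * ((b - 1) * ev b f)).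
Proof.
have lb : lam * b = 1 by rewrite /b mulfV // gt_eqF.
elim: k f => [|k IH] f bf.
  exists [::]; split => // y; case: bf; rewrite leqn0 size_poly_eq0 => /eqP -> _.
  by rewrite ev0 expr0 /=; ring.
have [g [e [/IH[u [su hu]] he ->]]] := bdig_split_last bf.
exists ((if e == 1 then hi else lo) :: u); split; first by rewrite /= su.
move=> y; rewrite /= -/(wmap u y) hu /ifs_map !evE.
have lbk : lam ^+ k * b ^+ k = 1 by rewrite -exprMn lb expr1n.
have -> : p (if e == 1 then hi else lo) = p lo + e%:~R * (p hi - p lo).
  have : e = 0 \/ e = 1 by clear -he; lia.
  by move=> [->|->] /=; [rewrite mulr0z|rewrite mulr1z]; ring.
rewrite exprS.
have -> : lam * lam ^+ k * (y - p lo + (p hi - p lo) * ((b - 1) * (e%:~R * b ^+ k + ev b g))) =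
  lam * lam ^+ k * (y - p lo + (p hi - p lo) * ((b - 1) * ev b g)) +
  (p hi - p lo) * e%:~R * (lam * b - lam) * (lam ^+ k * b ^+ k) by ring.
by rewrite lb lbk; ring.
Qed.

(** The word w maps the open hull onto an interval with left end [lw], and [dense_orbit] provides u
    such that the preimage of x under u lies there. *)
Lemma dense_words (m : nat) : (1 < m)%N -> b ^+ m < 2 -> ~ separated (b ^+ m) ->
  forall x, p lo < x < p hi -> forall w,
  exists u x', p lo < x' < p hi /\ x = wmap (u ++ w) x'.
Proof.
move=> m1 bm nsep x hx w.
have b1 : 1 < b by rewrite /b invf_gt1.
have lb : lam * b = 1 by rewrite /b mulfV // gt_eqF.
have D0 : 0 < p hi - p lo by rewrite subr_gt0.
pose xi := (x - p lo) / (p hi - p lo).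
have xE : x = p lo + (p hi - p lo) * xi by rewrite /xi; field; rewrite gt_eqF.
have hxi : 0 < xi < 1.
  by rewrite /xi divr_gt0 ?ltr_pdivrMr //=; lra.
pose lw := wmap w (p lo); pose e := lam ^+ size w.
have e0 : 0 < e by rewrite exprn_gt0.
have [k [f [bf hf]]] := dense_orbit ((lw - p lo) / (p hi - p lo)) b1 m1 bm nsep hxi e0.
have [u [su hu]] := word_of_bdig bf.
pose y := p lo + (p hi - p lo) * (b ^+ k * xi - (b - 1) * ev b f).
have uy : wmap u y = x.
  rewrite hu /y xE; have lbk : lam ^+ k * b ^+ k = 1 by rewrite -exprMn lb expr1n.
  transitivity (p lo + (p hi - p lo) * xi * (lam ^+ k * b ^+ k)); first by ring.
  by rewrite lbk mulr1.
have hy : lw < y < lw + e * (p hi - p lo).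
  rewrite /y; case/andP: hf => h1 h2; apply/andP; split.
    by move: h1; rewrite ltr_pdivrMr //; lra.
  have dE : (p hi - p lo) * ((lw - p lo) / (p hi - p lo)) = lw - p lo.
    by rewrite mulrC mulfVK // gt_eqF.
  move: h2; rewrite -(ltr_pM2l D0) => h2; move: dE h2.
  by move: ((lw - p lo) / (p hi - p lo)) => c dE h2; lra.
pose x' := p lo + (y - lw) / e.
have wx : wmap w x' = y.
  have := word_mapB lam p w x' (p lo); rewrite -/lw -/e => h.
  by rewrite -[LHS](subrK lw) h /x'; field; rewrite gt_eqF.
exists u, x'; split; last by rewrite word_map_cat wx uy.
have h : 0 < (y - lw) / e < p hi - p lo.
  by rewrite divr_gt0 ?ltr_pdivrMr //=; lra.
by rewrite /x'; lra.
Qed.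

End Coding.

(** * The interior of the attractor as the set of universal points *)

Lemma interior_attractor_X_uni (R : realType) (n : nat) (p : 'I_n.+1 -> R) (X : set R)
  (lam : R) (m : nat) :
  (exists i j, p i != p j) -> is_attractor lam p X -> 1 / 2 < lam -> lam < 1 ->
  (1 < m)%N -> lam^-1 ^+ m < 2 -> ~ separated (lam^-1 ^+ m) ->
  interior X = X_uni lam p X.
Proof.
move=> [i [j pij]] hX lam0 lam1 m1 bm nsep.
pose lo := [arg min_(k < i) p k]%O; pose hi := [arg max_(k > i) p k]%O.
have p_lo k : p lo <= p k by rewrite /lo; case: arg_minP => // l _ h; exact: h.
have p_hi k : p k <= p hi by rewrite /hi; case: arg_maxP => // l _ h; exact: h.
have lohi : p lo < p hi.
  rewrite lt_neqAle (le_trans (p_lo i)) // andbT; apply: contraNneq pij => e.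
  have := p_lo i; have := p_hi i; have := p_lo j; have := p_hi j; rewrite e.
  by move=> h1 h2 h3 h4; rewrite eq_le; apply/andP; split; lra.
rewrite (interior_attractor lam0 lam1 p_lo p_hi lohi hX).
have dense := dense_words lam0 lam1 lohi m1 bm nsep.
apply/seteqP; split => x /=; last first.
  by move=> [_ [a [ua <-]]]; exact: (universal_coding_interior lam0 lam1 p_lo p_hi lohi).
move=> hx; split; last exact: (universal_coding_exists lam0 lam1 p_lo p_hi dense).
rewrite (attractorE lam0 lam1 p_lo p_hi lohi hX) /= in_itv /=.
by case/andP: hx => /ltW -> /ltW ->.
Qed.

Lemma lt_sqrtV (R : realType) (c lam : R) : 0 < c -> (Num.sqrt c)^-1 < lam ->
  0 < lam /\ lam^-1 ^+ 2 < c.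
Proof.
move=> c0 h; have s0 : 0 < Num.sqrt c by rewrite sqrtr_gt0.
have lam0 : 0 < lam by apply: lt_trans h; rewrite invr_gt0.
split=> //; rewrite -[X in _ < X](sqr_sqrtr (ltW c0)) ltr_pXn2r // ?nnegrE ?invr_ge0 ?ltW //.
by rewrite -[X in _ < X]invrK ltf_pV2 ?posrE ?invr_gt0.
Qed.

Unset Implicit Arguments.

Theorem theorem6p1 (R : realType) (n : nat) (p : 'I_n.+1 -> R) (X : set R)
  (hF : exists i j : 'I_n.+1, p i != p j) (lam : R)
  (hX : is_attractor lam p X) :
  ((Num.sqrt 2)^-1 < lam < 1 -> ~ pisot (lam ^- 2) ->
     interior X = X_uni lam p X) /\
  (forall theta : R, theta ^+ 3 - theta - 1 = 0 ->
     (Num.sqrt theta)^-1 < lam < 1 -> interior X = X_uni lam p X).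
Proof.
split=> [/andP[h lam1] npisot | theta th /andP[h lam1]].
  have [lam0 b2] := lt_sqrtV (ltr0Sn _ 1) h.
  have b1 : 1 < lam^-1 by rewrite invf_gt1.
  have lb : lam * lam^-1 = 1 by rewrite mulfV // gt_eqF.
  have lam2 : 1 / 2 < lam by move: b1 b2 lb; move: lam^-1 => b; nra.
  apply: (@interior_attractor_X_uni _ _ _ _ _ 2) => // sep; apply: npisot.
  have q1 : 1 < lam^-1 ^+ 2 by rewrite exprn_egt1.
  have [Q [Qm Qirr Q0 Qconj]] := separated_pisot q1 b2 sep.
  rewrite -exprVn; split => //; exists Q; split => //; split => //; split; first exact/eqP.
  by move=> z /eqP z0; exact: Qconj.
have th1 : 0 < theta.
  rewrite ltNge; apply/negP => t0.
  have t1 : theta <= -1 by have := sqr_ge0 theta; move: th; nra.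
  have : (theta + 1) * (theta * (theta - 1)) <= 0 by rewrite mulr_le0_ge0; nra.
  by move: th; lra.
(* The cubic is positive from 53/40 on, and 53/40 < (144/125)^2. *)
have th2 : theta < 53 / 40.
  by rewrite ltNge; apply/negP => t0; move: th; nra.
have [lam0 bth] := lt_sqrtV th1 h.
have b1 : 1 < lam^-1 by rewrite invf_gt1.
have lb : lam * lam^-1 = 1 by rewrite mulfV // gt_eqF.
have b2 : lam^-1 ^+ 2 < 53 / 40 by exact: lt_trans bth th2.
have lam2 : 1 / 2 < lam by move: b1 b2 lb; move: lam^-1 => b; nra.
have b3 : lam^-1 ^+ 3 < 2 by move: b1 b2; move: lam^-1 => b; nra.
(* The digits are interleaved with period 2 or 3, according to which power of 1/lam is not
   separated. *)
have [s|s] := not_separated_small_base b1 b2.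
  by apply: (@interior_attractor_X_uni _ _ _ _ _ 2) => //; lra.
exact: (@interior_attractor_X_uni _ _ _ _ _ 3).
Qed.
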